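(* Let $n=p+q$, let $b$ be a non-degenerate symmetric bilinear form of signature $(p,q)$ on $\mathbb R^n$, let $1\le i\le n-1$, let $E\to Gr(i,\mathbb R^n)$ be the tautological bundle, and let $\sigma_1\in\Gamma(S^2E^* )$ be the section whose value at $V\in Gr(i,\mathbb R^n)$ is $b|_{V\times V}$. Let $(r,s)$ be a pair with $0\le r\le p$, $0\le s\le q$ and $r+s<i$, and let $x\in\mathcal O_{(r,s)}$ be a point. Then there are open neighborhoods $U$ of $x$ in $Gr(i,\mathbb R^n)$ and $\underline U\subset U\cap\mathcal O_{(r,s)}$ of $x$ in $\mathcal O_{(r,s)}$, and there is a smooth subbundle $\tilde E\subset E|_U$ of rank $\nu:=i-r-s$ such that - for each $y\in U$, the null-space of $\sigma_1(y)$ is contained in $\tilde E_y\subset E_y$; - the obvious projection of $\sigma_1$ to a section of $S^2\tilde E^*$ over $U$ (restriction of bilinear forms from $E$ to $\tilde E$) is a defining section for $\underline U$.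
   Context: $\mathcal O_{(r,s)}\subset Gr(i,\mathbb R^n)$ is the orbit, under $H=SO(p,q)$ (the special orthogonal group of $b$), consisting of the $i$-dimensional subspaces $W$ for which $b|_{W\times W}$ has signature $(r,s)$, endowed with its orbit (initial submanifold) structure. The fiber of $E$ over $V\in Gr(i,\mathbb R^n)$ is $V$. The null-space of $\sigma_1(y)$ is $\{v\in E_y:\sigma_1(y)(v,w)=0\ \forall w\in E_y\}$. Defining sections: let $N\subset M$ be a smooth submanifold of codimension $k$ and $F\to M$ a smooth vector bundle of rank $k$. A section $\sigma$ of $F$ defined on an open set $U$ is a (local) defining section for $N$ if for each $y\in U\cap N$ we have $\sigma(y)=0$ and the linear map $\nabla\sigma(y):T_yM\to F_y$ is surjective, where $\nabla$ is any linear connection on $F$ (the map is independent of the choice because $\sigma(y)=0$). Part of the claim is that $\underline U$ is a smooth submanifold of codimension $\nu(\nu+1)/2=\operatorname{rank}(S^2\tilde E^* )$. *)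

(* Defs.v *)
From HB Require Import structures.
From mathcomp Require Import all_boot all_order all_algebra.
From mathcomp Require Import all_classical all_reals all_analysis.

Set Implicit Arguments.
Unset Strict Implicit.
Unset Printing Implicit Defensive.

Import Order.TTheory GRing.Theory Num.Theory.
Import numFieldNormedType.Exports.

Local Open Scope classical_set_scope.
Local Open Scope ring_scope.

(* Only meaningful on open sets O of finite-dimensional spaces, where it agrees
   with the usual class C^k. *)
Fixpoint Ck (R : realType) (V W : normedModType R) (k : nat) (O : set V)
    (f : V -> W) : Prop :=
  if k is k'.+1 then
    (forall x, O x -> differentiable f x) /\
    (forall v, Ck k' O (fun x => 'D_v f x))
  else forall x, O x -> {for x, continuous f}.

Definition smooth_on (R : realType) (V W : normedModType R) (O : set V)
    (f : V -> W) : Prop := forall k, Ck k O f.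

Definition diffeo (R : realType) (V : normedModType R) (O O' : set V)
    (f g : V -> V) : Prop :=
  [/\ open O, open O', smooth_on O f, smooth_on O' g &
      (forall x, O x -> O' (f x) /\ g (f x) = x) /\
      (forall z, O' z -> O (g z) /\ f (g z) = z)].

(* symform V is S^2 V^*, as a vector space. *)
Definition is_symform (R : realType) (V : lmodType R) (f : V -> V -> R^o) :
    Prop :=
  (forall a u v w, f (a *: u + v) w = a * f u w + f v w) /\
  (forall u v, f u v = f v u).

Definition symform_pred (R : realType) (V : lmodType R) :
  pred (V -> V -> R^o) := fun f => `[< is_symform f >].

Record symform (R : realType) (V : lmodType R) := SymForm {
  symform_fun :> V -> V -> R^o;
  _ : symform_fun \in @symform_pred R V }.

HB.instance Definition _ (R : realType) (V : lmodType R) :=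
  [isSub for @symform_fun R V].
HB.instance Definition _ (R : realType) (V : lmodType R) :=
  [Choice of symform V by <:].

Lemma symform_submod (R : realType) (V : lmodType R) :
  submod_closed (@symform_pred R V).
Proof.
split; first by apply/asboolP; split=> [a u v w|//] /=; rewrite mulr0 addr0.
move=> a f g /asboolP[fl fs] /asboolP[gl gs]; apply/asboolP; split.
- move=> c u v w; rewrite !fctE /= fl gl.
  rewrite /GRing.scale /= !mulrDr addrACA; congr (_ + _ + _).
  by rewrite !mulrA (mulrC a).
- by move=> u v; rewrite !fctE /= fs gs.
Qed.

HB.instance Definition _ (R : realType) (V : lmodType R) :=
  GRing.isSubmodClosed.Build R (V -> V -> R^o) (@symform_pred R V)
    (@symform_submod R V).
HB.instance Definition _ (R : realType) (V : lmodType R) :=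
  [SubChoice_isSubLmodule of symform V by <:].

Lemma symform_pull_subproof (R : realType) (V W : lmodType R)
    (l : {linear V -> W}) (f : symform W) :
  (fun u v => f (l u) (l v)) \in @symform_pred R V.
Proof.
case: f => f /= /asboolP[fl fs]; apply/asboolP; split.
- by move=> a u v w; rewrite linearP fl.
- by move=> u v; rewrite fs.
Qed.

Definition symform_pull (R : realType) (V W : lmodType R)
    (l : {linear V -> W}) (f : symform W) : symform V :=
  SymForm (symform_pull_subproof l f).

Definition null_space (R : realType) (V : lmodType R) (f : symform V) : set V :=
  [set v | forall w, f v w = 0].

Definition nondegenerate_form (R : realType) (V : lmodType R) (f : symform V) :
  Prop := forall v, null_space f v -> v = 0.

(* Some basis of V diagonalizes f with r entries 1, then s entries -1, then
   only zeros. *)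
Definition has_signature (R : realType) (V : vectType R) (f : symform V)
    (r s : nat) : Prop :=
  (r + s <= \dim {:V})%N /\
  exists2 e : (\dim {:V}).-tuple V, basis_of fullv e &
    forall k l, f (tnth e k) (tnth e l) =
      if k != l then 0
      else if (k < r)%N then 1
      else if (k < r + s)%N then -1 else 0.

Record Gr (R : realType) (i n : nat) := MkGr {
  Gr_vs :> {vspace 'rV[R]_n};
  _ : \dim Gr_vs == i }.

HB.instance Definition _ (R : realType) (i n : nat) := [isSub for @Gr_vs R i n].
HB.instance Definition _ (R : realType) (i n : nat) :=
  [Choice of Gr R i n by <:].

Definition row_vs (R : realType) (m n : nat) (A : 'M[R]_(m, n)) :
  {vspace 'rV[R]_n} := <<[tuple row k A | k < m]>>%VS.

(* For i <= n a chart index is a pair of frames (A, C) of two complementary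
   subspaces of R^n, of dimensions i and n - i; the corresponding affine chart
   identifies the subspaces complementary to that of C with the graphs of linear
   maps from the first subspace to the second. *)
Record chart (R : realType) (i n : nat) := Chart {
  chart_frame : 'M[R]_(i, n);
  chart_coframe : 'M[R]_(n - i, n);
  chart_free : row_free (col_mx chart_frame chart_coframe) }.

Lemma chart_param_subproof (R : realType) (i n : nat) (c : chart R i n)
    (X : 'M[R]_(i, n - i)) :
  \dim (row_vs (chart_frame c + X *m chart_coframe c)) == i.
Proof.
case: c => A C AC_free /=; set M := A + X *m C.
have Mfree u : u *m M = 0 -> u = 0.
  move=> uM; have : row_mx u (u *m X) *m col_mx A C = 0 *m col_mx A C.
    by rewrite mul_row_col mul0mx -mulmxA -mulmxDr.
  by move/(row_free_inj AC_free)/(congr1 lsubmx); rewrite row_mxKl linear0.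
suff /eqP-> : free [tuple row k M | k < i] by rewrite size_tuple.
apply/freeP => k; under eq_bigr do rewrite -tnth_nth tnth_mktuple.
move=> kM j; have /Mfree/rowP/(_ j) : (\row_j k j) *m M = 0.
  by rewrite mulmx_sum_row -[RHS]kM; apply: eq_bigr => l _; rewrite mxE.
by rewrite !mxE.
Qed.

(* The inverse of an affine chart, defined on the whole model space. *)
Definition chart_param (R : realType) (i n : nat) (c : chart R i n)
    (X : 'M[R]_(i, n - i)) : Gr R i n := MkGr (chart_param_subproof c X).

Definition Gr_open (R : realType) (i n : nat) : set_system (Gr R i n) :=
  [set U | forall c : chart R i n, open (chart_param c @^-1` U)].

Lemma Gr_openT (R : realType) (i n : nat) : @Gr_open R i n setT.
Proof. by move=> c; rewrite preimage_setT; exact: openT. Qed.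

Lemma Gr_openI (R : realType) (i n : nat) : setI_closed (@Gr_open R i n).
Proof. by move=> U V Uo Vo c; rewrite preimage_setI; exact: openI. Qed.

Lemma Gr_open_bigU (R : realType) (i n : nat) (I : Type)
    (f : I -> set (Gr R i n)) :
  (forall k, Gr_open (f k)) -> Gr_open (\bigcup_k f k).
Proof.
by move=> fo c; rewrite preimage_bigcup; apply: bigcup_open => k _; exact: fo.
Qed.

HB.instance Definition _ (R : realType) (i n : nat) :=
  isOpenTopological.Build (Gr R i n) (@Gr_openT R i n) (@Gr_openI R i n)
    (@Gr_open_bigU R i n).

Definition Gr_smooth (R : realType) (i n : nat) (W : normedModType R)
    (U : set (Gr R i n)) (f : Gr R i n -> W) : Prop :=
  forall c : chart R i n, smooth_on (chart_param c @^-1` U) (f \o chart_param c).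

(* Embedded submanifolds of codimension k, by local straightening. *)
Definition submanifold (R : realType) (i n : nat) (k : nat)
    (N : set (Gr R i n)) : Prop :=
  forall y, N y -> exists (c : chart R i n) (O O' : set 'M[R]_(i, n - i))
      (f g : 'M[R]_(i, n - i) -> 'M[R]_(i, n - i))
      (L : {vspace 'M[R]_(i, n - i)}),
    [/\ (chart_param c @` O) y, diffeo O O' f g,
        (\dim L + k = i * (n - i))%N &
        forall X, O X -> (N (chart_param c X) <-> f X \in L)].

(* The image of y under v |-> v *m h, or y if that image has a smaller
   dimension. *)
Definition Gr_act (R : realType) (i n : nat) (y : Gr R i n) (h : 'M[R]_n) :
  Gr R i n := insubd y (linfun (mulmxr h) @: y)%VS.

(* A matrix L represents, at each y, the tangent vector of the curve
   t |-> y (1 + t L); under T_y Gr = Hom(y, R^n / y) this is the class of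
   v |-> v *m L.  Hence every tangent vector at y is represented, two matrices
   represent the same one iff their difference maps y to itself, and every
   smooth vector field is a combination with smooth coefficients of the fields
   represented by constant matrices. *)
Definition Gr_tangent0 (R : realType) (i n : nat) (y : Gr R i n) (L : 'M[R]_n) :
  Prop := forall v, v \in (y : {vspace _}) -> v *m L \in (y : {vspace _}).

Definition Gr_deriv (R : realType) (i n : nat) (L : 'M[R]_n)
    (f : Gr R i n -> R^o) (y : Gr R i n) : R^o :=
  derive1 (fun t : R => f (Gr_act y (1%:M + t *: L))) 0.

(* A vector bundle over an open set is given by its fibers F and by its smooth
   sections over open subsets.  All sections are total functions, whose values
   outside the open set of interest are irrelevant. *)
Definition section_class (R : realType) (i n : nat)
    (F : Gr R i n -> lmodType R) : Type :=
  set (Gr R i n) -> (forall y, F y) -> Prop.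

(* By the description of tangent vectors above, nabla L s y is the covariant
   derivative of s along the tangent vector at y represented by L. *)
Record linear_connection (R : realType) (i n : nat)
    (F : Gr R i n -> lmodType R) (Gamma : section_class F) (U : set (Gr R i n))
    (nabla : 'M[R]_n -> (forall y, F y) -> (forall y, F y)) : Prop :=
  LinearConnection {
    connection_smooth : forall L s, Gamma U s -> Gamma U (nabla L s);
    connection_ext : forall L s t, Gamma U s -> Gamma U t ->
      (forall y, U y -> s y = t y) ->
      forall y, U y -> nabla L s y = nabla L t y;
    connection_tangentP : forall a L L' s, Gamma U s -> forall y, U y ->
      nabla (a *: L + L') s y = a *: nabla L s y + nabla L' s y;
    connection_tangent0 : forall L s, Gamma U s -> forall y, U y ->
      Gr_tangent0 y L -> nabla L s y = 0;
    connectionD : forall L s t, Gamma U s -> Gamma U t -> forall y, U y ->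
      nabla L (fun z => s z + t z) y = nabla L s y + nabla L t y;
    connection_Leibniz : forall L (f : Gr R i n -> R^o) s,
      Gr_smooth U f -> Gamma U s -> forall y, U y ->
      nabla L (fun z => f z *: s z) y =
        Gr_deriv L f y *: s y + f y *: nabla L s y }.

Definition defining_section (R : realType) (i n : nat)
    (F : Gr R i n -> lmodType R) (Gamma : section_class F)
    (U N : set (Gr R i n)) (sigma : forall y, F y) : Prop :=
  Gamma U sigma /\
  forall y, U y -> N y ->
    sigma y = 0 /\
    forall nabla, linear_connection Gamma U nabla ->
      forall f : F y, exists L, nabla L sigma y = f.

Definition bundle_section (R : realType) (i n : nat)
    (E' : Gr R i n -> {vspace 'rV[R]_n}) (U : set (Gr R i n))
    (e : forall y, subvs_of (E' y)) : Prop :=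
  Gr_smooth U (fun y => vsval (e y)).

(* Subbundles of E over U; the fiber of E over y is y itself. *)
Definition smooth_subbundle (R : realType) (i n : nat) (U : set (Gr R i n))
    (E' : Gr R i n -> {vspace 'rV[R]_n}) (nu : nat) : Prop :=
  (forall y, U y -> (E' y <= y)%VS /\ \dim (E' y) = nu) /\
  forall y, U y -> exists (U' : set (Gr R i n))
      (e : 'I_nu -> forall z, subvs_of (E' z)),
    [/\ open_nbhs y U', U' `<=` U, forall k, bundle_section U' (e k) &
        forall z, U' z -> basis_of (E' z) [tuple vsval (e k z) | k < nu]].

Definition S2_fiber (R : realType) (i n : nat)
    (E' : Gr R i n -> {vspace 'rV[R]_n}) (y : Gr R i n) : lmodType R :=
  symform (subvs_of (E' y)).

Definition S2_section (R : realType) (i n : nat)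
    (E' : Gr R i n -> {vspace 'rV[R]_n}) : section_class (S2_fiber E') :=
  fun U s => forall U' (e f : forall y, subvs_of (E' y)),
    open U' -> U' `<=` U -> bundle_section U' e -> bundle_section U' f ->
    Gr_smooth U' (fun y => (s y : symform _) (e y) (f y)).

Definition sigma1 (R : realType) (i n : nat) (b : symform 'rV[R]_n)
    (y : Gr R i n) : symform (subvs_of y) := symform_pull vsval b.

(* When E' y is contained in y, vsproj y \o vsval is the inclusion. *)
Definition S2_restr (R : realType) (i n : nat)
    (E' : Gr R i n -> {vspace 'rV[R]_n})
    (s : forall y : Gr R i n, symform (subvs_of y)) (y : Gr R i n) :
  S2_fiber E' y := symform_pull (vsproj y \o vsval : {linear _ -> _}) (s y).

Definition SO (R : realType) (n : nat) (b : symform 'rV[R]_n) : set 'M[R]_n :=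
  [set h | \det h = 1 /\ forall u v, b (u *m h) (v *m h) = b u v].

Definition sig_orbit (R : realType) (i n : nat) (b : symform 'rV[R]_n) (r s : nat) :
  set (Gr R i n) := [set y | has_signature (sigma1 b y) r s].

(* Openness for the orbit topology, the one making h |-> y h a quotient map from
   SO(b) onto the orbit of y.  For p = q = i and r = s = 0 the set sig_orbit b r s
   consists of two orbits, and this gives their topological disjoint union. *)
Definition orbit_open (R : realType) (i n : nat) (b : symform 'rV[R]_n)
    (r s : nat) (A : set (Gr R i n)) : Prop :=
  A `<=` sig_orbit b r s /\
  forall y, sig_orbit b r s y ->
    exists2 T : set 'M[R]_n, open T &
      forall h, SO b h -> (A (Gr_act y h) <-> T h).

(* Main.v *)
Require Import Defs.
From HB Require Import structures.
From mathcomp Require Import all_boot all_order all_algebra.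
From mathcomp Require Import all_classical all_reals all_analysis.
From mathcomp Require Import ring lra zify.
Import Order.TTheory GRing.Theory Num.Theory.
Import numFieldNormedType.Exports.
Local Open Scope classical_set_scope.
Local Open Scope ring_scope.

Set Implicit Arguments.
Unset Strict Implicit.
Unset Printing Implicit Defensive.

(** Let [A] be a basis of [x] in which [b] is diagonal, with [r] entries [1],
then [s] entries [-1], then [nu] zeros, and complete it to a basis [(A, C)] of
the whole space. A subspace [y] near [x] has a unique frame [M = A + X C]. Let
[M1] be the first [r + s] rows of [M] and [M2] the last [nu] ones. The Gram
matrix of [M1] is close to [diag(1, -1)], so it is invertible and has signature
[(r, s)] ([near_sgn_mx]). The fibre of the subbundle at [y] is the orthogonal
complement of [M1] in [y]. Elimination gives the frame
[e = M2 - (M2 J M1^T) (M1 J M1^T)^-1 M1] of it ([kframe]), which depends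
rationally on [X]; here [J] is the matrix of [b]. Null vectors of [b] on [y] are
orthogonal to [M1], so they lie in this fibre. Moreover [b] on [y] is the
orthogonal sum of a form of signature [(r, s)] and the restriction to the fibre,
so [y] has signature [(r, s)] if and only if the Gram matrix [e J e^T], a Schur
complement, vanishes ([admissible_sigP]).

The zero set of [e J e^T] is a submanifold by an explicit change of coordinates.
Around a point [y] of the orbit, use a chart centred at [y] for which the row
space of [C] contains an isotropic family [F], dual to the null vectors of [y]
and orthogonal to [C] and to the other vectors of [A] ([adapted_coframe]).
Adding [Y F] to [M2] changes [e J e^T] by exactly [Y + Y^T] ([kgram_kshift]).
Therefore [e J e^T] is the sum of the symmetrization of a linear function of [X]
and of a remainder that is invariant under such shifts. Shifting by half of the
remainder is a diffeomorphism, inverted by the opposite shift, which turns the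
equation [e J e^T = 0] into a linear one. The number of independent equations is
the dimension of the space of symmetric matrices of size [nu].

The restriction of [b] to the fibres is a combination of constant symmetric
forms whose coefficients are the entries of [e J e^T], because coordinates with
respect to [e] are constant linear forms ([S2_fiber_expand]). At a zero, the
Leibniz rule expresses any connection by derivatives of these coefficients
([connection_at_zero]). Along [y (1 + t L)] the derivative of [e J e^T] is
[(e L) J e^T + e J (e L)^T] ([Gr_deriv_kgramGr]): variations of [e] inside [y] do
not count since [e] is then orthogonal to [y]. As [b] is non-degenerate, [L] can
be chosen so that this is any given symmetric matrix.

The functions involved are rational in matrix entries, so that their smoothness
follows from closure under the field operations. *)

(** * Smooth functions *)

Section Calculus.
Variables (R : realType) (V : normedModType R).
Implicit Types (O : set V) (k : nat).

(** Differentiability is a local property: the difference of two functions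
that agree near [x] vanishes near [x], so it is differentiable there. *)
Lemma near_differentiable (W : normedModType R) (f g : V -> W) x :
  (\forall y \near x, f y = g y) -> differentiable f x -> differentiable g x.
Proof.
move=> fg df.
suff dh : differentiable (g - f) x.
  by rewrite -(subrK f g); exact: differentiableD.
have e0 : continuous (0 : V -> W) /\
    (g - f) \o shift x = cst ((g - f) x) + (0 : V -> W) +o_ 0 id.
  split; first exact: cst_continuous.
  apply/eqaddoP => _/posnumP[e].
  have : \forall y \near (0 : V), f (y + x) = g (y + x).
    by move: fg; rewrite (near_shift 0 x) subr0.
  apply: filterS => y /= fgy.
  rewrite !fctE /= fgy (nbhs_singleton fg) !subrr addr0 subrr normr0.
  by rewrite mulr_ge0.
apply/diff_locallyP.
have -> : 'd (g - f) x = 0 :> (V -> W).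
  by apply: (@diff_unique _ _ _ _ (\0 : {linear V -> W})); case: e0.
exact: e0.
Qed.

Lemma Ck_ext (W : normedModType R) k O (f g : V -> W) :
  open O -> (forall x, O x -> f x = g x) -> Ck k O f -> Ck k O g.
Proof.
move=> Oo; elim: k f g => [|k IH] f g fg /=.
  move=> fc x Ox; have nfg : \forall y \near x, f y = g y.
    by apply: filterS fg _; exact: open_nbhs_nbhs.
  rewrite /prop_for /continuous_at -(fg x Ox).
  exact: cvg_trans (near_eq_cvg nfg) (fc x Ox).
move=> [fd fD]; split.
  move=> x Ox; apply: near_differentiable (fd x Ox).
  by apply: filterS fg _; exact: open_nbhs_nbhs.
move=> v; apply: IH (fD v) => x Ox; apply: near_eq_derive.
by apply: filterS fg _; exact: open_nbhs_nbhs.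
Qed.

Lemma Ck_sub (W : normedModType R) k O O' (f : V -> W) :
  O' `<=` O -> Ck k O f -> Ck k O' f.
Proof.
move=> OO; elim: k f => [|k IH] f /=; first by move=> fc x /OO; exact: fc.
by move=> [fd fD]; split=> [x /OO|v]; [exact: fd|exact: IH].
Qed.

Lemma Ck_pred (W : normedModType R) k O (f : V -> W) : Ck k.+1 O f -> Ck k O f.
Proof.
elim: k f => [|k IH] f.
  by case=> fd _ x Ox; exact/differentiable_continuous/fd.
by case=> fd fD; split=> // v; apply: IH; exact: fD.
Qed.

Lemma Ck_cst (W : normedModType R) k O (a : W) : Ck k O (fun=> a).
Proof.
elim: k a => [|k IH] a /=; first by move=> x _; exact: cst_continuous.
split=> [x _|v]; first exact: differentiable_cst.
by under eq_fun do rewrite derive_cst; exact: IH.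
Qed.

Lemma CkD (W : normedModType R) k O (f g : V -> W) :
  open O -> Ck k O f -> Ck k O g -> Ck k O (fun x => f x + g x).
Proof.
move=> Oo; elim: k f g => [|k IH] f g /=.
  by move=> fc gc x Ox; apply: cvgD; [exact: fc|exact: gc].
move=> [fd fD] [gd gD]; split=> [x Ox|v].
  by apply: differentiableD; [exact: fd|exact: gd].
apply: Ck_ext (IH _ _ (fD v) (gD v)) => // x Ox.
by rewrite deriveD//; apply: diff_derivable; [exact: fd|exact: gd].
Qed.

Lemma CkM k O (f g : V -> R^o) :
  open O -> Ck k O f -> Ck k O g -> Ck k O (fun x => f x * g x : R^o).
Proof.
move=> Oo; elim: k f g => [|k IH] f g.
  by move=> fc gc x Ox; apply: cvgM; [exact: fc|exact: gc].
move=> fk gk; have [fd fD] := fk; have [gd gD] := gk; split=> [x Ox|v].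
  by apply: differentiableM; [exact: fd|exact: gd].
have fk' := Ck_pred fk; have gk' := Ck_pred gk.
apply: Ck_ext (CkD Oo (IH _ _ fk' (gD v)) (IH _ _ gk' (fD v))) => // x Ox.
by rewrite deriveM//; apply: diff_derivable; [exact: fd|exact: gd].
Qed.

(** The derivative of [1/f] is [-(1/f)^2 f'], which involves [1/f] itself but
only with one order of smoothness less; this is what the induction needs. *)
Lemma CkV k O (f : V -> R^o) :
  open O -> (forall x, O x -> f x != 0) -> Ck k O f ->
  Ck k O (fun x => (f x)^-1 : R^o).
Proof.
move=> Oo f0; elim: k => [|k IH].
  by move=> fc x Ox; apply: cvgV; [exact: f0|exact: fc].
move=> fk; have [fd fD] := fk; split=> [x Ox|v].
  by apply: differentiableV; [exact: fd|exact: f0].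
have fVk := IH (Ck_pred fk).
have := CkM Oo (CkM Oo (Ck_cst _ _ (-1 : R^o)) (CkM Oo fVk fVk)) (fD v).
apply: Ck_ext => // x Ox; rewrite deriveV ?f0//; last exact/diff_derivable/fd.
by rewrite mulN1r expr2 invfM.
Qed.

(** Reduces the calculus of matrix-valued functions to scalar functions, so
that smoothness of products, determinants and inverses of matrices follows
from the closure of smooth scalar functions under the field operations. *)
Lemma Ck_mxP k O m n (F : V -> 'M[R]_(m, n)) : open O ->
  Ck k O F <-> forall i j, Ck k O (fun x => F x i j : R^o).
Proof.
move=> Oo; split.
  elim: k F => [|k IH] F.
    move=> Fc i j x Ox.
    apply: (@continuous_comp _ _ _ F (fun M : 'M[R]_(m, n) => M i j)).
      exact: Fc.
    exact: coord_continuous.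
  move=> [Fd FD] i j; split=> [x Ox|v].
    apply: (@differentiable_comp _ _ _ _ F (fun M : 'M[R]_(m, n) => M i j : R^o)).
      exact: Fd.
    exact: differentiable_coord.
  apply: Ck_ext (IH _ (FD v) i j) => // x Ox.
  by rewrite derive_mx ?mxE//; exact/diff_derivable/Fd.
elim: k F => [|k IH] F Fij.
  move=> x Ox A [P FP sPA]; 
  apply: (@filterS _ (nbhs x) _ [set y | forall i j, P i j (F y i j)]).
    by move=> y Py; exact: sPA.
  by apply: filter_forall => i; apply: filter_forall => j; exact/Fij/FP.
have Fd x : O x -> differentiable F x.
  move=> Ox; have -> : F = \sum_(i < m) \sum_(j < n)
      (fun x => F x i j *: delta_mx i j : 'M[R]_(m, n)).
    apply/funext => y; rewrite fct_sumE [LHS]matrix_sum_delta.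
    by apply: eq_bigr => i _; rewrite fct_sumE.
  apply: differentiable_sum => i; apply: differentiable_sum => j.
  by apply: differentiableZl; exact: (Fij i j).1.
split=> // v; apply/IH => i j; apply: Ck_ext ((Fij i j).2 v) => // x Ox.
by rewrite derive_mx ?mxE//; exact/diff_derivable/Fd.
Qed.
End Calculus.

Section SmoothCalculus.
Variables (R : realType) (V : normedModType R) (O : set V).
Hypothesis Oo : open O.

Lemma smooth_ext (W : normedModType R) (f g : V -> W) :
  (forall x, O x -> f x = g x) -> smooth_on O f -> smooth_on O g.
Proof. by move=> fg fs k; apply: Ck_ext (fs k). Qed.

Lemma smooth_sub (W : normedModType R) O' (f : V -> W) :
  O' `<=` O -> smooth_on O f -> smooth_on O' f.
Proof. by move=> OO fs k; apply: Ck_sub (fs k). Qed.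

Lemma smooth_cst (W : normedModType R) (a : W) : smooth_on O (fun=> a).
Proof. by move=> k; exact: Ck_cst. Qed.

Lemma smoothD (W : normedModType R) (f g : V -> W) :
  smooth_on O f -> smooth_on O g -> smooth_on O (fun x => f x + g x).
Proof. by move=> fs gs k; exact: CkD. Qed.

Lemma smoothM (f g : V -> R^o) :
  smooth_on O f -> smooth_on O g -> smooth_on O (fun x => f x * g x : R^o).
Proof. by move=> fs gs k; exact: CkM. Qed.

Lemma smoothV (f : V -> R^o) : (forall x, O x -> f x != 0) ->
  smooth_on O f -> smooth_on O (fun x => (f x)^-1 : R^o).
Proof. by move=> f0 fs k; exact: CkV. Qed.

Lemma smooth_sum (W : normedModType R) I (s : seq I) (P : pred I)
    (f : I -> V -> W) :
  (forall i, P i -> smooth_on O (f i)) ->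
  smooth_on O (fun x => \sum_(i <- s | P i) f i x).
Proof.
move=> fs; elim: s => [|a s IH].
  rewrite (_ : (fun _ => _) = (fun=> 0)); first exact: smooth_cst.
  by apply/funext => x; rewrite big_nil.
case Pa : (P a); last first.
  rewrite (_ : (fun _ => _) = (fun x => \sum_(i <- s | P i) f i x)) //.
  by apply/funext => x; rewrite big_cons Pa.
rewrite (_ : (fun _ => _) = (fun x => f a x + \sum_(i <- s | P i) f i x)).
  by apply: smoothD => //; exact: fs.
by apply/funext => x; rewrite big_cons Pa.
Qed.

Lemma smooth_prod I (s : seq I) (f : I -> V -> R^o) :
  (forall i, smooth_on O (f i)) ->
  smooth_on O (fun x => \prod_(i <- s) f i x : R^o).
Proof.
move=> fs; elim: s => [|a s IH].
  rewrite (_ : (fun _ => _) = (fun=> 1)); first exact: smooth_cst.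
  by apply/funext => x; rewrite big_nil.
rewrite (_ : (fun _ => _) = (fun x => f a x * \prod_(i <- s) f i x)).
  exact: smoothM.
by apply/funext => x; rewrite big_cons.
Qed.

Lemma smooth_continuous (W : normedModType R) (f : V -> W) x :
  smooth_on O f -> O x -> {for x, continuous f}.
Proof. by move=> fs; exact: (fs 0). Qed.

Lemma smooth_mxP m n (F : V -> 'M[R]_(m, n)) :
  smooth_on O F <-> forall i j, smooth_on O (fun x => F x i j : R^o).
Proof.
split=> [Fs i j k|Fij k]; first exact: (Ck_mxP k F Oo).1.
by apply: (Ck_mxP k F Oo).2 => i j; exact: Fij.
Qed.

Lemma smooth_mulmx m n p (F : V -> 'M[R]_(m, n)) (G : V -> 'M[R]_(n, p)) :
  smooth_on O F -> smooth_on O G -> smooth_on O (fun x => F x *m G x).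
Proof.
move=> /smooth_mxP Fs /smooth_mxP Gs; apply/smooth_mxP => i j.
under eq_fun do rewrite mxE; apply: smooth_sum => k _.
by apply: smoothM; [exact: Fs|exact: Gs].
Qed.

Lemma smoothZ m n (f : V -> R^o) (F : V -> 'M[R]_(m, n)) :
  smooth_on O f -> smooth_on O F -> smooth_on O (fun x => f x *: F x).
Proof.
move=> fs /smooth_mxP Fs; apply/smooth_mxP => i j.
by under eq_fun do rewrite mxE; apply: smoothM => //; exact: Fs.
Qed.

Lemma smoothN m n (F : V -> 'M[R]_(m, n)) :
  smooth_on O F -> smooth_on O (fun x => - F x).
Proof.
by under eq_fun do rewrite -scaleN1r; apply: smoothZ; exact: smooth_cst.
Qed.

(** Covers transposition, submatrices and minors at once. *)
Lemma smooth_reindex m n p q (F : V -> 'M[R]_(m, n)) (G : V -> 'M[R]_(p, q))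
    (h : 'I_p -> 'I_q -> 'I_m * 'I_n) :
  (forall x i j, G x i j = F x (h i j).1 (h i j).2) ->
  smooth_on O F -> smooth_on O G.
Proof.
move=> GF /smooth_mxP Fs; apply/smooth_mxP => i j.
by under eq_fun do rewrite GF; exact: Fs.
Qed.

Lemma smooth_trmx m n (F : V -> 'M[R]_(m, n)) :
  smooth_on O F -> smooth_on O (fun x => (F x)^T).
Proof.
by apply: (smooth_reindex (h := fun i j => (j, i))) => x i j; rewrite mxE.
Qed.

Lemma smooth_usubmx m1 m2 n (F : V -> 'M[R]_(m1 + m2, n)) :
  smooth_on O F -> smooth_on O (fun x => usubmx (F x)).
Proof.
apply: (smooth_reindex (h := fun i j => (lshift _ i, j))) => x i j.
by rewrite mxE.
Qed.

Lemma smooth_dsubmx m1 m2 n (F : V -> 'M[R]_(m1 + m2, n)) :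
  smooth_on O F -> smooth_on O (fun x => dsubmx (F x)).
Proof.
apply: (smooth_reindex (h := fun i j => (rshift _ i, j))) => x i j.
by rewrite mxE.
Qed.

Lemma smooth_lsubmx m n1 n2 (F : V -> 'M[R]_(m, n1 + n2)) :
  smooth_on O F -> smooth_on O (fun x => lsubmx (F x)).
Proof.
apply: (smooth_reindex (h := fun i j => (i, lshift _ j))) => x i j.
by rewrite mxE.
Qed.

Lemma smooth_row m n (F : V -> 'M[R]_(m, n)) k :
  smooth_on O F -> smooth_on O (fun x => row k (F x)).
Proof.
by apply: (smooth_reindex (h := fun i j => (k, j))) => x i j; rewrite mxE.
Qed.

Lemma smooth_row_mx m n1 n2 (F : V -> 'M[R]_(m, n1)) (G : V -> 'M[R]_(m, n2)) :
  smooth_on O F -> smooth_on O G -> smooth_on O (fun x => row_mx (F x) (G x)).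
Proof.
move=> /smooth_mxP Fs /smooth_mxP Gs; apply/smooth_mxP => i j.
under eq_fun do rewrite mxE; case: splitP => k _; [exact: Fs|exact: Gs].
Qed.

Lemma smooth_col_mx m1 m2 n (F : V -> 'M[R]_(m1, n)) (G : V -> 'M[R]_(m2, n)) :
  smooth_on O F -> smooth_on O G -> smooth_on O (fun x => col_mx (F x) (G x)).
Proof.
move=> /smooth_mxP Fs /smooth_mxP Gs; apply/smooth_mxP => i j.
under eq_fun do rewrite mxE; case: splitP => k _; [exact: Fs|exact: Gs].
Qed.

Lemma smooth_det n (F : V -> 'M[R]_n) :
  smooth_on O F -> smooth_on O (fun x => \det (F x) : R^o).
Proof.
move=> /smooth_mxP Fs; apply: smooth_sum => s _.
by apply: smoothM; [exact: smooth_cst|apply: smooth_prod => i; exact: Fs].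
Qed.

(** By the formula of Cramer, inversion is a rational function. *)
Lemma smooth_invmx n (F : V -> 'M[R]_n) :
  (forall x, O x -> F x \in unitmx) -> smooth_on O F ->
  smooth_on O (fun x => invmx (F x)).
Proof.
move=> FU Fs; apply: (@smooth_ext _ (fun x => (\det (F x))^-1 *: \adj (F x))).
  by move=> x Ox; rewrite /invmx FU.
apply: smoothZ.
  apply: smoothV; last exact: smooth_det.
  by move=> x /FU; rewrite unitmxE unitfE.
apply/smooth_mxP => i j; under eq_fun do rewrite mxE.
apply: smoothM; first exact: smooth_cst.
apply: smooth_det.
apply: (smooth_reindex (h := fun a b => (lift j a, lift i b))) Fs => x a b.
by rewrite !mxE.
Qed.

Lemma smooth_open_preimage (f : V -> R^o) (A : set R) :
  open A -> smooth_on O f -> open [set x | O x /\ A (f x)].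
Proof.
move=> Ao fs; rewrite openE => x [Ox Afx]; rewrite /interior.
have nO : nbhs x O by exact: open_nbhs_nbhs.
have := smooth_continuous fs Ox => /(_ _ (open_nbhs_nbhs (conj Ao Afx))) /=.
by apply: filterS2 nO => y.
Qed.

End SmoothCalculus.

Lemma smooth_id_mx (R : realType) m n (O : set 'M[R]_(m, n)) :
  open O -> smooth_on O (fun X => X).
Proof.
move=> Oo; apply/smooth_mxP => // i j [|k].
  by move=> x _; exact: coord_continuous.
split=> [x _|v]; first exact: differentiable_coord.
apply: (@Ck_ext _ _ _ _ _ (fun=> v i j : R^o)) => //; last exact: Ck_cst.
move=> x Ox.
have dX : derivable (fun X : 'M[R]_(m, n) => X) x v by exact: derivable_id.
by have /matrixP/(_ i j) := derive_mx dX; rewrite mxE derive_id.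
Qed.

Lemma smooth_idR (R : realType) (O : set R^o) :
  open O -> smooth_on O (fun t => t).
Proof.
move=> Oo [|k]; first by move=> x _; exact: cvg_id.
split=> [x _|v]; first exact: ex_diff.
by under eq_fun do rewrite derive_id; exact: Ck_cst.
Qed.

(** * Symmetric matrices and signature *)

Section PositiveForms.
Variable R : realType.

Definition posdef n (A : 'M[R]_n) : Prop :=
  forall u : 'rV_n, u != 0 -> 0 < (u *m A *m u^T) 0 0.

Definition sgn_mx r s : 'M[R]_(r + s) := block_mx 1%:M 0 0 (-1)%:M.

Definition schur m n (a : 'M[R]_m) (b : 'M[R]_(m, n)) (d : 'M[R]_n) : 'M[R]_n :=
  d - b^T *m invmx a *m b.

Definition elim_mx m n (a : 'M[R]_m) (b : 'M[R]_(m, n)) : 'M[R]_(m + n) :=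
  block_mx 1%:M 0 (- (b^T *m invmx a)) 1%:M.

Lemma elim_mx_unit m n (a : 'M[R]_m) (b : 'M[R]_(m, n)) : elim_mx a b \in unitmx.
Proof. by rewrite unitmxE det_lblock !det1 mulr1 unitr1. Qed.

Lemma schur_congr m n (a : 'M[R]_m) (b : 'M[R]_(m, n)) d :
  a \in unitmx -> a^T = a ->
  elim_mx a b *m block_mx a b b^T d *m (elim_mx a b)^T =
    block_mx a 0 0 (schur a b d).
Proof.
move=> aU aT; rewrite /elim_mx tr_block_mx !mulmx_block.
rewrite !(mul1mx, mul0mx, trmx1, trmx0, mulmx1, mulmx0, add0r, addr0).
rewrite mulNmx -mulmxA mulVmx // mulmx1 addNr mul0mx add0r mulNmx addrC.
congr block_mx; last by rewrite addrC.
rewrite raddfN /= trmx_mul trmxK trmx_inv aT.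
by rewrite mulmxN mulmxA mulmxV // mul1mx subrr.
Qed.

Lemma posdef_unit n (A : 'M[R]_n) : posdef A -> A \in unitmx.
Proof.
move=> Apos; rewrite -row_free_unit -kermx_eq0; apply/eqP/row_matrixP => k.
rewrite row0; apply: contraTeq isT => /Apos.
have -> : row k (kermx A) *m A = 0 by apply/sub_kermxP; exact: row_sub.
by rewrite mul0mx mxE ltxx.
Qed.

Lemma posdef_congr m n (A : 'M[R]_n) (P : 'M[R]_(m, n)) :
  row_free P -> posdef A -> posdef (P *m A *m P^T).
Proof.
move=> Pf Apos u u0; have := Apos (u *m P); rewrite trmx_mul !mulmxA; apply.
by apply: contra u0 => /eqP uP; apply/eqP/(row_free_inj Pf); rewrite uP mul0mx.
Qed.

Lemma posdef_dsub m n a b c (d : 'M[R]_n) :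
  posdef (block_mx (a : 'M[R]_m) b c d) -> posdef d.
Proof.
move=> dpos u u0; have := dpos (row_mx 0 u).
rewrite tr_row_mx mul_row_block !mul0mx !add0r mul_row_col trmx0 mulmx0 add0r.
by apply; apply: contra u0 => /eqP/(congr1 rsubmx); rewrite row_mxKr linear0 => ->.
Qed.

(** Induction on the size: eliminating the first row and column leaves a Schur
complement, which is again positive definite because it is a block of a
matrix congruent to [A]. *)
Lemma cholesky n (A : 'M[R]_n) : A^T = A -> posdef A ->
  exists2 g : 'M[R]_n, g \in unitmx & g *m A *m g^T = 1%:M.
Proof.
elim: n A => [|n IH] A AT Apos.
  by exists 1%:M; [exact: unitmx1|apply/matrixP; case].
rewrite -[n.+1]/(1 + n)%N in A AT Apos *.
set a := ulsubmx A; set b := ursubmx A; set d := drsubmx A.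
have Ablk : A = block_mx a b b^T d.
  rewrite -[LHS]submxK -/a -/b -/d; congr block_mx.
  by rewrite /b trmx_ursub AT.
have a0 : 0 < a 0 0.
  have := Apos (row_mx 1%:M 0).
  rewrite Ablk tr_row_mx mul_row_block !mul0mx !addr0 mul_row_col trmx0 mulmx0 addr0.
  rewrite !mul1mx trmx1 mulmx1; apply.
  apply/eqP => /(congr1 lsubmx)/matrixP/(_ 0 0).
  by rewrite row_mxKl !mxE => /eqP; rewrite oner_eq0.
have aU : a \in unitmx by rewrite unitmxE det_mx11 unitfE gt_eqF.
have aT : a^T = a by apply/matrixP => i j; rewrite mxE !ord1.
have := schur_congr b d aU aT; rewrite -Ablk.
set L := elim_mx a b; set S := schur a b d => LA.
have ST : S^T = S.
  have /(congr1 drsubmx) := congr1 trmx LA.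
  by rewrite !trmx_mul trmxK AT mulmxA LA tr_block_mx !block_mxKdr => <-.
have Spos : posdef S.
  apply: (@posdef_dsub 1 n a 0 0); rewrite -LA; apply: posdef_congr => //.
  by rewrite row_free_unit elim_mx_unit.
have [h hU hS] := IH S ST Spos.
exists (block_mx (Num.sqrt (a 0 0))^-1%:M 0 0 h *m L).
  rewrite unitmx_mul elim_mx_unit andbT unitmxE det_ublock unitrM -!unitmxE hU andbT.
  by rewrite unitmxE det_mx11 mxE mulr1n unitfE invr_eq0 gt_eqF // sqrtr_gt0.
rewrite trmx_mul -!mulmxA [L *m _]mulmxA [in L *m A *m _]mulmxA LA.
rewrite tr_block_mx !trmx0 !mulmx_block !(mul0mx, mulmx0, addr0, add0r) !mulmxA hS.
rewrite [RHS](scalar_mx_block 1 n); congr block_mx.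
apply/matrixP => i j; rewrite !ord1 tr_scalar_mx mul_scalar_mx mul_mx_scalar !mxE /= mulr1n.
move: a0; rewrite /a !mxE => a0.
by rewrite mulrA -invfM -expr2 sqr_sqrtr ?ltW // mulVf ?gt_eqF.
Qed.

(** The quadratic form of [A - 1] is at most [e n] times the square norm, by
[2 |u_k u_l| <= u_k^2 + u_l^2]. *)
Lemma posdef_near1 n (A : 'M[R]_n) (e : R) : 0 <= e -> e * n%:R < 1 ->
  (forall k l, `|A k l - (k == l)%:R| < e) -> posdef A.
Proof.
move=> e0 en Ae u u0.
have u2 : 0 < \sum_k u 0 k ^+ 2.
  have [k uk] : exists k, u 0 k != 0 by apply/rV0Pn.
  rewrite (bigD1 k) //= ltr_pwDl // ?exprn_even_gt0 //.
  by apply: sumr_ge0 => j _; exact: sqr_ge0.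
have -> : (u *m A *m u^T) 0 0 =
    \sum_k u 0 k ^+ 2 + \sum_k \sum_l (A k l - (k == l)%:R) * (u 0 k * u 0 l).
  rewrite -big_split /= mxE.
  transitivity (\sum_l \sum_k u 0 k * A k l * u 0 l).
    by apply: eq_bigr => l _; rewrite !mxE mulr_suml.
  rewrite exchange_big /=; apply: eq_bigr => k _.
  have -> : u 0 k ^+ 2 = \sum_l (k == l)%:R * (u 0 k * u 0 l).
    rewrite (bigD1 k) //= eqxx mul1r big1 ?addr0 ?expr2 // => l lk.
    by rewrite eq_sym (negbTE lk) mul0r.
  by rewrite -big_split; apply: eq_bigr => l _ /=; rewrite -mulrDl addrC subrK; ring.
have : `|\sum_k \sum_l (A k l - (k == l)%:R) * (u 0 k * u 0 l)| <=
    e * n%:R * \sum_k u 0 k ^+ 2.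
  apply: (le_trans (ler_norm_sum _ _ _)).
  apply: (@le_trans _ _ (\sum_k \sum_l e * ((u 0 k ^+ 2 + u 0 l ^+ 2) / 2))).
    apply: ler_sum => k _; apply: (le_trans (ler_norm_sum _ _ _)).
    apply: ler_sum => l _; rewrite normrM; apply: ler_pM => //; first exact: ltW.
    rewrite ler_norml; have := sqr_ge0 (u 0 k - u 0 l).
    have := sqr_ge0 (u 0 k + u 0 l).
    by rewrite !expr2; nra.
  set U := \sum_k u 0 k ^+ 2.
  have -> : \sum_k \sum_l e * ((u 0 k ^+ 2 + u 0 l ^+ 2) / 2) =
      \sum_(k < n) e / 2 * (n%:R * u 0 k ^+ 2 + U).
    apply: eq_bigr => k _; rewrite -mulr_sumr -mulr_suml big_split /=.
    rewrite sumr_const card_ord -/U.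
    by rewrite -mulr_natl; ring.
  rewrite -mulr_sumr big_split /= -mulr_sumr sumr_const card_ord -/U -mulr_natl.
  by lra.
by rewrite ler_norml => /andP[+ _]; nra.
Qed.

(** An explicit form of the local constancy of the signature. The upper left
block is near the identity, hence positive definite; the lower right block is
negative definite and stays so in the Schur complement, which subtracts from
it a positive semidefinite matrix. Each of the two diagonal blocks is then
normalized by [cholesky]. *)
Lemma near_sgn_mx r s (G : 'M[R]_(r + s)) : G^T = G ->
  (forall k l, `|G k l - sgn_mx r s k l| < (r + s).+1%:R^-1) ->
  exists2 g : 'M[R]_(r + s), g \in unitmx & g *m G *m g^T = sgn_mx r s.
Proof.
move=> GT Gn; set e : R := _^-1 in Gn.
have e0 : 0 <= e by rewrite invr_ge0 ler0n.
set a := ulsubmx G; set b := ursubmx G; set d := drsubmx G.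
have Gblk : G = block_mx a b b^T d.
  rewrite -[LHS]submxK -/a -/b -/d; congr block_mx.
  by rewrite /b trmx_ursub GT.
have aT : a^T = a by rewrite /a trmx_ulsub GT.
have dT : d^T = d by rewrite /d trmx_drsub GT.
have apos : posdef a.
  apply: (posdef_near1 e0) => [|k l].
    by rewrite mulrC ltr_pdivrMr ?ltr0n // mul1r ltr_nat ltnS leq_addr.
  by have := Gn (lshift s k) (lshift s l); rewrite block_mxEul /a !mxE.
have dneg : posdef (- d).
  apply: (posdef_near1 e0) => [|k l].
    by rewrite mulrC ltr_pdivrMr ?ltr0n // mul1r ltr_nat ltnS leq_addl.
  have := Gn (rshift r k) (rshift r l); rewrite block_mxEdr /d !mxE mulNrn opprK.
  by rewrite -normrN opprD.
have aU := posdef_unit apos.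
have := schur_congr b d aU aT; rewrite -Gblk.
set L := elim_mx a b; set S := schur a b d => LG.
have ST : S^T = S.
  have /(congr1 drsubmx) := congr1 trmx LG.
  by rewrite !trmx_mul trmxK GT mulmxA LG tr_block_mx !block_mxKdr => <-.
have [g gU gG] := cholesky aT apos.
have aV : invmx a = g^T *m g.
  have /mulmx1C gga : (g *m a) *m g^T = 1%:M by rewrite gG.
  by rewrite -[LHS]mul1mx -gga !mulmxA mulmxK.
have Sneg : posdef (- S).
  move=> u u0; rewrite /S /schur opprD opprK mulmxDr mulmxDl mxE ltr_pwDl ?dneg //.
  rewrite aV; set w := g *m b *m u^T.
  have -> : u *m (b^T *m (g^T *m g) *m b) *m u^T = w^T *m w.
    by rewrite /w !trmx_mul trmxK !mulmxA.
  by rewrite mxE sumr_ge0 // => k _; rewrite mxE -expr2 sqr_ge0.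
have [|h hU hS] := cholesky _ Sneg; first by rewrite linearN /= ST.
exists (block_mx g 0 0 h *m L).
  by rewrite unitmx_mul elim_mx_unit andbT unitmxE det_ublock unitrM -!unitmxE gU hU.
rewrite trmx_mul -!mulmxA [L *m _]mulmxA [in L *m G *m _]mulmxA LG.
rewrite tr_block_mx !trmx0 !mulmx_block !(mul0mx, mulmx0, addr0, add0r) !mulmxA gG.
by rewrite /sgn_mx raddfN /= -hS mulmxN mulNmx opprK.
Qed.
End PositiveForms.

(** * Frames of a subspace, normalized by a chart *)

Section NormalizedFrames.
Variables (R : realType) (n r s nu d : nat).
Local Notation i := (r + s + nu)%N.
Variables (J : 'M[R]_n) (A : 'M[R]_(i, n)) (C : 'M[R]_(d, n)).
Hypothesis JT : J^T = J.
Hypothesis AC_free : row_free (col_mx A C).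

(** For a frame [B] of a subspace, [coef B] holds the coordinates along [A] of
the rows of [B] in the basis [(A, C)] of the whole space. It is invertible
when the subspace lies in the domain of the chart. *)
Definition coef (B : 'M[R]_(i, n)) : 'M[R]_i :=
  lsubmx (B *m pinvmx (col_mx A C)).

(** The frame of the form [A + X *m C] of the row space of [B]; it depends on
this row space only ([nframeM]). *)
Definition nframe B : 'M[R]_(i, n) := invmx (coef B) *m B.

Definition gram11 B : 'M[R]_(r + s) :=
  usubmx (nframe B) *m J *m (usubmx (nframe B))^T.

(** Coefficients, with respect to [B], of the frame obtained from the last
[nu] rows of [nframe B] by subtracting their [J]-orthogonal projections to
the span of the first [r + s] rows. Keeping the factor [B] visible in
[kframe] is what makes the derivative in [Gr_deriv_kgramGr] easy to read
off. *)
Definition kcoef B : 'M[R]_(nu, i) :=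
  row_mx (- (dsubmx (nframe B) *m J *m (usubmx (nframe B))^T
               *m invmx (gram11 B))) 1%:M *m invmx (coef B).

Definition kframe B : 'M[R]_(nu, n) := kcoef B *m B.

Definition kgram B : 'M[R]_nu := kframe B *m J *m (kframe B)^T.

(** The bound is the one of [near_sgn_mx]; it guarantees that [gram11 B] has
signature [(r, s)]. *)
Definition admissible B : Prop := coef B \in unitmx /\
  forall k l, `|gram11 B k l - sgn_mx R r s k l| < (r + s).+1%:R^-1.

Lemma coefM g B : coef (g *m B) = g *m coef B.
Proof. by rewrite /coef -mulmxA mulmx_lsub. Qed.

Lemma coef_chart X : coef (A + X *m C) = 1%:M.
Proof.
rewrite /coef (_ : A + X *m C = row_mx 1%:M X *m col_mx A C); last first.
  by rewrite mul_row_col mul1mx.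
by rewrite -mulmxA mulmxVp // mulmx1 row_mxKl.
Qed.

Lemma nframe_chart X : nframe (A + X *m C) = A + X *m C.
Proof. by rewrite /nframe coef_chart invmx1 mul1mx. Qed.

Lemma nframeM g B :
  g \in unitmx -> coef B \in unitmx -> nframe (g *m B) = nframe B.
Proof.
move=> gU BU; have gBU : g *m coef B \in unitmx by rewrite unitmx_mul gU.
rewrite /nframe coefM; apply: (can_inj (mulKmx gBU)).
by rewrite mulKVmx // -mulmxA mulKVmx.
Qed.

Lemma kframe_decomp B :
  kframe B = dsubmx (nframe B) - dsubmx (nframe B) *m J *m (usubmx (nframe B))^T
               *m invmx (gram11 B) *m usubmx (nframe B).
Proof.
rewrite /kframe /kcoef -[LHS]mulmxA -[invmx _ *m B]/(nframe B).
by rewrite -[X in _ *m X = _]vsubmxK mul_row_col mul1mx mulNmx addrC.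
Qed.

Lemma kframeM g B :
  g \in unitmx -> coef B \in unitmx -> kframe (g *m B) = kframe B.
Proof. by move=> gU BU; rewrite !kframe_decomp /gram11 nframeM. Qed.

Lemma admissibleM g B : g \in unitmx -> admissible B -> admissible (g *m B).
Proof.
move=> gU [BU Bg]; split; first by rewrite coefM unitmx_mul gU.
by rewrite /gram11 nframeM.
Qed.

Lemma admissible_chart X : admissible (A + X *m C) <->
  forall k l, `|(usubmx (A + X *m C) *m J *m (usubmx (A + X *m C))^T) k l
     - sgn_mx R r s k l| < (r + s).+1%:R^-1.
Proof.
rewrite /admissible /gram11 nframe_chart coef_chart.
by split=> [[]//|?]; split=> //; exact: unitmx1.
Qed.

Lemma gram11T B : (gram11 B)^T = gram11 B.
Proof. by rewrite /gram11 !trmx_mul trmxK JT mulmxA. Qed.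

Lemma admissible_gram11 B : admissible B ->
  exists2 g, g \in unitmx & g *m gram11 B *m g^T = sgn_mx R r s.
Proof. by case=> _; apply: near_sgn_mx; exact: gram11T. Qed.

Lemma sgn_mx_unit : sgn_mx R r s \in unitmx.
Proof.
by rewrite unitmxE det_ublock unitrM det1 unitr1 det_scalar unitrX // unitrN1.
Qed.

Lemma admissible_unit B : admissible B -> gram11 B \in unitmx.
Proof.
move=> /admissible_gram11[g gU gG]; have := sgn_mx_unit; rewrite -gG !unitmx_mul.
by case/andP => /andP[].
Qed.

(** The coordinates of [kframe B] along the last [nu] rows of [A] form the
identity matrix. Hence coordinates with respect to [kframe B] are given by
linear forms that do not depend on [B]. *)
Lemma kframe_coord B : coef B \in unitmx ->
  rsubmx (lsubmx (kframe B *m pinvmx (col_mx A C))) = 1%:M.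
Proof.
move=> BU; rewrite /kframe -mulmxA -mulmx_lsub -/(coef B) /kcoef mulmxKV //.
by rewrite row_mxKr.
Qed.

Lemma kframe_free B : coef B \in unitmx -> row_free (kframe B).
Proof.
move=> BU; apply/row_freeP; exists (rsubmx (lsubmx (pinvmx (col_mx A C)))).
by rewrite mulmx_rsub mulmx_lsub kframe_coord.
Qed.

Lemma kframe_sub B : (kframe B <= B)%MS. Proof. exact: submxMl. Qed.

Lemma nframe_eqmx B : coef B \in unitmx -> (nframe B :=: B)%MS.
Proof. by move=> BU; apply: eqmxMfull; rewrite row_full_unit unitmx_inv. Qed.

Lemma kframe_orth B : gram11 B \in unitmx ->
  kframe B *m J *m (usubmx (nframe B))^T = 0.
Proof.
move=> GU; rewrite kframe_decomp !mulmxBl; set X := _ *m (usubmx (nframe B))^T.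
rewrite -(mulmxA (X *m _) _ J) -(mulmxA (X *m _)) -/(gram11 B).
by rewrite mulmxKV ?subrr.
Qed.

(** A vector of the null space is orthogonal to the first [r + s] rows of
[nframe B], and [kframe B] spans the orthogonal complement of these rows
within the row space of [B]. *)
Lemma null_sub_kframe B (v : 'rV_n) : admissible B ->
  (v <= B)%MS -> v *m J *m B^T = 0 -> (v <= kframe B)%MS.
Proof.
move=> Bg; have [BU _] := Bg; have GU := admissible_unit Bg.
rewrite -(nframe_eqmx BU) => /submxP[u ->{v}] vB.
set M1 := usubmx (nframe B); set M2 := dsubmx (nframe B).
have : u *m nframe B *m J *m M1^T = 0.
  by rewrite /M1 /nframe -mul_usub_mx trmx_mul mulmxA vB mul0mx.
rewrite -{1 2}[nframe B]vsubmxK -[u]hsubmxK mul_row_col -/M1 -/M2.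
set u1 := lsubmx u; set u2 := rsubmx u; rewrite !mulmxDl -!(mulmxA u1) -/(gram11 B).
move=> /(congr1 (mulmx^~ (invmx (gram11 B)))); rewrite mul0mx mulmxDl mulmxK //.
move=> /eqP; rewrite addr_eq0 => /eqP u1E.
apply/submxP; exists u2; rewrite kframe_decomp -/M1 -/M2 mulmxBr.
by rewrite u1E mulNmx addrC !mulmxA.
Qed.

(** The matrix [J] restricted to the row space of [B] is the orthogonal sum of
[gram11 B], of signature [(r, s)], and [kgram B]. If the whole has signature
[(r, s)] then its null space has dimension [nu]; being contained in the span of
[kframe B], it is equal to it, so [kgram B] vanishes. *)
Lemma admissible_sigP B : row_free B -> admissible B ->
  (exists2 B' : 'M[R]_(i, n), (B' :=: B)%MS &
     B' *m J *m B'^T = block_mx (sgn_mx R r s) 0 0 0) <-> kgram B = 0.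
Proof.
move=> Bf Bg; have [BU _] := Bg; have GU := admissible_unit Bg; split.
  case=> B' B'B B'J; set K0 := dsubmx B'.
  have K0E : K0 = row_mx 0 1%:M *m B'.
    by rewrite -[B' in RHS]vsubmxK mul_row_col mul0mx mul1mx add0r.
  have K0J : K0 *m J *m B'^T = 0.
    rewrite K0E -!mulmxA (mulmxA B') B'J mul_row_block.
    by rewrite !mul0mx !mulmx0 !addr0 row_mx0.
  have B'f : row_free B' by rewrite -row_leq_rank B'B row_leq_rank.
  have K0k : (K0 <= kframe B)%MS.
    apply/row_subP => k; apply: null_sub_kframe => //.
      by rewrite -B'B (submx_trans (row_sub _ _)) // K0E submxMl.
    have /submxP[h ->] : (B <= B')%MS by rewrite B'B.
    by rewrite -!row_mul trmx_mul mulmxA K0J mul0mx row0.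
  have K0f : row_free K0.
    apply/row_freeP; exists (pinvmx B' *m col_mx 0 1%:M).
    rewrite K0E mulmxA -(mulmxA _ B') mulmxVp // mulmx1.
    by rewrite mul_row_col mul0mx mul1mx add0r.
  have kK0 : (kframe B <= K0)%MS.
    rewrite -(geq_leqif (mxrank_leqif_sup K0k)).
    by rewrite (eqP (kframe_free BU)) (eqP K0f).
  case/submxP: kK0 => g kE; rewrite /kgram kE.
  rewrite trmx_mul {2}K0E trmx_mul !mulmxA -(mulmxA g) -(mulmxA g) K0J.
  by rewrite mulmx0 !mul0mx.
move=> k0; have [g gU gG] := admissible_gram11 Bg.
have kM1 := kframe_orth GU.
(* Conversely, [g] diagonalizes the first summand and the second one is
   zero. *)
exists (col_mx (g *m usubmx (nframe B)) (kframe B)).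
  apply: eqmx_trans (nframe_eqmx BU).
  set X := dsubmx (nframe B) *m J *m (usubmx (nframe B))^T
             *m invmx (gram11 B).
  have -> : col_mx (g *m usubmx (nframe B)) (kframe B) =
      block_mx g 0 (- X) 1%:M *m nframe B.
    rewrite -{2}[nframe B]vsubmxK mul_block_col mul0mx addr0 mul1mx mulNmx.
    by rewrite kframe_decomp addrC.
  by apply: eqmxMfull; rewrite row_full_unit unitmxE det_lblock det1 mulr1.
rewrite mul_col_mx tr_col_mx mul_col_row -/(kgram B) k0 trmx_mul !mulmxA kM1 mul0mx.
have M1k : usubmx (nframe B) *m J *m (kframe B)^T = 0.
  by apply: trmx_inj; rewrite trmx0 trmx_mul trmxK trmx_mul JT mulmxA.
by rewrite -(mulmxA g _ J) -!(mulmxA g (_ *m J)) M1k mulmx0 gG.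
Qed.

Section Smoothness.
Variables (V : normedModType R) (O : set V) (Bf : V -> 'M[R]_(i, n)).
Hypotheses (Oo : open O) (Bs : smooth_on O Bf).

Lemma smooth_coef : smooth_on O (fun v => coef (Bf v)).
Proof.
by apply: smooth_lsubmx => //; apply: smooth_mulmx => //; exact: smooth_cst.
Qed.

Hypothesis BU : forall v, O v -> coef (Bf v) \in unitmx.

Lemma smooth_nframe : smooth_on O (fun v => nframe (Bf v)).
Proof.
by apply: smooth_mulmx => //; apply: smooth_invmx => //; exact: smooth_coef.
Qed.

Lemma smooth_gram11 : smooth_on O (fun v => gram11 (Bf v)).
Proof.
have Ns := smooth_nframe; have Nus := smooth_usubmx Oo Ns.
apply: smooth_mulmx => //; last exact: smooth_trmx.
by apply: smooth_mulmx => //; exact: smooth_cst.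
Qed.

Hypothesis GU : forall v, O v -> gram11 (Bf v) \in unitmx.

Lemma smooth_kcoef : smooth_on O (fun v => kcoef (Bf v)).
Proof.
have Ns := smooth_nframe; have Nus := smooth_usubmx Oo Ns.
have Nds := smooth_dsubmx Oo Ns; have Gs := smooth_gram11.
apply: smooth_mulmx => //; last by apply: smooth_invmx => //; exact: smooth_coef.
apply: smooth_row_mx => //; last exact: smooth_cst.
apply: smoothN => //; apply: smooth_mulmx => //; last exact: smooth_invmx.
apply: smooth_mulmx => //; last exact: smooth_trmx.
by apply: smooth_mulmx => //; exact: smooth_cst.
Qed.

Lemma smooth_kframe : smooth_on O (fun v => kframe (Bf v)).
Proof. by apply: smooth_mulmx => //; exact: smooth_kcoef. Qed.

Lemma smooth_kgram : smooth_on O (fun v => kgram (Bf v)).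
Proof.
have ks := smooth_kframe.
apply: smooth_mulmx => //; last exact: smooth_trmx.
by apply: smooth_mulmx => //; exact: smooth_cst.
Qed.

End Smoothness.

Lemma open_coef_unit (V : normedModType R) (O : set V) Bf :
  open O -> smooth_on O Bf -> open [set v | O v /\ coef (Bf v) \in unitmx].
Proof.
move=> Oo Bs; have dets := smooth_det Oo (smooth_coef Oo Bs).
rewrite (_ : [set v | _] = [set v | O v /\ [set t | t != 0] (\det (coef (Bf v)))]).
  by apply: smooth_open_preimage => //; exact: open_neq.
by apply/seteqP; split=> v /=; rewrite unitmxE unitfE.
Qed.

Lemma open_admissible (V : normedModType R) (O : set V) Bf :
  open O -> smooth_on O Bf -> open [set v | O v /\ admissible (Bf v)].
Proof.
move=> Oo Bs; have O1o := open_coef_unit Oo Bs; set O1 := [set v | _] in O1o.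
have Gs : smooth_on O1 (fun v => gram11 (Bf v)).
  by apply: smooth_gram11 => //; [apply: smooth_sub Bs => v []|move=> v []].
have Gks := (smooth_mxP O1o _).1 Gs.
rewrite openE => v [Ov [vU vG]]; rewrite /interior.
have O1v : nbhs v O1 by apply: open_nbhs_nbhs.
have : nbhs v [set w | forall k l,
    `|gram11 (Bf w) k l - sgn_mx R r s k l| < (r + s).+1%:R^-1].
  apply: filter_forall => k; apply: filter_forall => l.
  apply: cvgr_norm_lt (vG k l); apply: cvgB; last exact: cvg_cst.
  exact: smooth_continuous (Gks k l) (conj Ov vU).
by apply: filterS2 O1v => w [Ow wU] wG.
Qed.


End NormalizedFrames.

Section AdaptedCharts.
Variables (R : realType) (n r s nu d : nat).
Local Notation i := (r + s + nu)%N.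
Variables (J : 'M[R]_n) (A : 'M[R]_(i, n)).
Hypotheses (JT : J^T = J) (JU : J \in unitmx).
Hypotheses (Af : row_free A) (nd : n = (i + d)%N).
Hypothesis AJ : A *m J *m A^T = block_mx (sgn_mx R r s) 0 0 0.

Local Notation E := (usubmx A).
Local Notation K := (dsubmx A).

Let EE : E *m J *m E^T = sgn_mx R r s.
Proof.
have := congr1 ulsubmx AJ; rewrite block_mxKul => <-.
by rewrite -[A in RHS]vsubmxK tr_col_mx mul_col_mx mul_col_row block_mxKul.
Qed.

Let KK : K *m J *m K^T = 0.
Proof.
have := congr1 drsubmx AJ; rewrite block_mxKdr => <-.
by rewrite -[A in RHS]vsubmxK tr_col_mx mul_col_mx mul_col_row block_mxKdr.
Qed.

Let KE : K *m J *m E^T = 0.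
Proof.
have := congr1 dlsubmx AJ; rewrite block_mxKdl => <-.
by rewrite -[A in RHS]vsubmxK tr_col_mx mul_col_mx mul_col_row block_mxKdl.
Qed.

(** A family dual to the null vectors [K] and orthogonal to [E] exists since [J]
is invertible. Adding a combination of the null vectors corrects the Gram
matrix [N] of such a family [F0]; the coefficient [1/2] is due to the two
cross terms, each of which contributes the same matrix. *)
Lemma dual_null_frame : exists F : 'M[R]_(nu, n),
  [/\ F *m J *m E^T = 0, F *m J *m K^T = 1%:M & F *m J *m F^T = 0].
Proof.
have AJf : row_free (A *m J).
  by rewrite /row_free mxrankMfree ?row_free_unit.
pose F0 := (pinvmx (A *m J) *m col_mx 0 1%:M)^T.
have AF0 : A *m J *m F0^T = col_mx 0 1%:M.
  by rewrite trmxK mulmxA mulmxVp // mul1mx.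
have EF0 : F0 *m J *m E^T = 0.
  apply: trmx_inj; rewrite trmx_mul trmxK trmx_mul JT mulmxA.
  rewrite -[A]vsubmxK !mul_col_mx in AF0.
  by case/eq_col_mx: AF0 => -> _; rewrite trmx0.
have KF0 : F0 *m J *m K^T = 1%:M.
  apply: trmx_inj; rewrite trmx_mul trmxK trmx_mul JT mulmxA.
  rewrite -[A]vsubmxK !mul_col_mx in AF0.
  by case/eq_col_mx: AF0 => _ ->; rewrite trmx1.
set N := F0 *m J *m F0^T.
have NT : N^T = N by rewrite /N trmx_mul trmxK trmx_mul JT mulmxA.
pose F := F0 - (2^-1 *: N) *m K.
have FK : F *m J *m K^T = 1%:M.
  by rewrite /F !mulmxBl KF0 -(mulmxA _ K J) -(mulmxA _ (K *m J)) KK mulmx0 subr0.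
exists F; split=> //.
  by rewrite /F !mulmxBl EF0 -(mulmxA _ K J) -(mulmxA _ (K *m J)) KE mulmx0 subr0.
have KF0' : K *m J *m F0^T = 1%:M.
  by apply: trmx_inj; rewrite trmx1 trmx_mul trmxK trmx_mul JT mulmxA.
rewrite {2}/F linearB /= mulmxBr trmx_mul linearZ /= NT mulmxA FK mul1mx.
rewrite /F !mulmxBl -/N -(mulmxA _ K J) -(mulmxA _ (K *m J)) KF0' mulmx1.
by apply/matrixP => k l; rewrite !mxE; lra.
Qed.

(** The complement of the row space of [A] is taken to be the orthogonal space
of [E] and [F]. It contains [F], because [F] is isotropic and orthogonal to
[E], and it meets the row space of [A] trivially because the pairing of [A]
with [(E, F)] is invertible. *)
Lemma adapted_coframe : exists (C : 'M[R]_(d, n)) (Pi : 'M[R]_(nu, d)),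
  [/\ row_free (col_mx A C), Pi *m C *m J *m E^T = 0,
      Pi *m C *m J *m K^T = 1%:M & Pi *m C *m J *m C^T = 0].
Proof.
have [F [FE FK FF]] := dual_null_frame.
pose G := col_mx E F.
have EF : E *m J *m F^T = 0.
  by apply: trmx_inj; rewrite trmx0 trmx_mul trmxK trmx_mul JT mulmxA.
have KF : K *m J *m F^T = 1%:M.
  by apply: trmx_inj; rewrite trmx1 trmx_mul trmxK trmx_mul JT mulmxA.
have AG : A *m (J *m G^T) = block_mx (sgn_mx R r s) 0 0 1%:M.
  by rewrite mulmxA -{1}[A]vsubmxK tr_col_mx mul_col_mx mul_col_row EE EF KE KF.
pose W := kermx (J *m G^T).
have rJG : \rank (J *m G^T) = i.
  apply/eqP; rewrite eqn_leq rank_leq_col.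
  apply: leq_trans (mxrankM_maxr A _).
  have /eqP -> // : row_full (A *m (J *m G^T)).
  by rewrite AG row_full_unit unitmxE det_ublock det1 mulr1 -unitmxE sgn_mx_unit.
have rW : \rank W = d by rewrite mxrank_ker rJG nd addKn.
have [C CW] : exists C : 'M[R]_(d, n), (C :=: W)%MS.
  by rewrite -rW; exists (row_base W); exact: eq_row_base.
have Cf : row_free C by rewrite /row_free CW rW.
have CG : C *m J *m G^T = 0 by rewrite -mulmxA; apply/sub_kermxP; rewrite CW.
have FW : (F <= C)%MS.
  rewrite CW; apply/sub_kermxP; rewrite mulmxA tr_col_mx mul_mx_row FE FF row_mx0 //.
case/submxP: FW => Pi FE'.
have FG : C *m J *m F^T = 0.
  by move: CG; rewrite tr_col_mx mul_mx_row -row_mx0 => /eq_row_mx[].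
exists C, Pi; rewrite -FE'; split=> //.
  rewrite -kermx_eq0; apply/rowV0P => u /sub_kermxP.
  rewrite -[u]hsubmxK mul_row_col => uAC.
  have := congr1 (mulmx^~ (J *m G^T)) uAC.
  rewrite mulmxDl -!mulmxA [C *m _]mulmxA CG mulmx0 addr0 mul0mx AG.
  have BU : block_mx (sgn_mx R r s) 0 0 1%:M \in @unitmx R i.
    by rewrite unitmxE det_ublock det1 mulr1 -unitmxE sgn_mx_unit.
  move=> /(congr1 (mulmx^~ (invmx (block_mx (sgn_mx R r s) 0 0 1%:M)))).
  rewrite mulmxK // mul0mx => u1; move: uAC; rewrite u1 mul0mx add0r => u2.
  by rewrite (row_free_inj Cf (etrans u2 (esym (mul0mx _ _)))) row_mx0.
by apply: trmx_inj; rewrite trmx0 trmx_mul trmxK trmx_mul JT mulmxA.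
Qed.

End AdaptedCharts.

(** * Straightening the zero set of the Schur complement *)

Lemma card_le_pairs nu :
  #|{: {p : 'I_nu * 'I_nu | p.1 <= p.2}}|%N = ((nu * (nu + 1)) %/ 2)%N.
Proof.
rewrite card_sig -sum1_card.
rewrite -(pair_big_dep predT (fun a b : 'I_nu => a <= b)%N (fun=> fun=> 1%N)) /=.
rewrite (exchange_big_dep predT) //=.
under eq_bigr => b _ do
  rewrite -(big_ord_widen _ (fun=> 1%N) (ltn_ord b)) sum1_card card_ord.
suff <- : (\sum_(b < nu) b.+1 * 2 = nu * (nu + 1))%N by rewrite -big_distrl mulnK.
elim: nu => [|nu IH]; first by rewrite big_ord0.
by rewrite big_ord_recr /= IH; lia.
Qed.

Section Straightening.
Variables (R : realType) (n r s nu d : nat).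
Local Notation i := (r + s + nu)%N.
Variables (J : 'M[R]_n) (A : 'M[R]_(i, n)) (C : 'M[R]_(d, n)).
Variable Pi : 'M[R]_(nu, d).
Hypothesis JT : J^T = J.
Hypothesis AC_free : row_free (col_mx A C).
Hypotheses (FE : Pi *m C *m J *m (usubmx A)^T = 0)
           (FK : Pi *m C *m J *m (dsubmx A)^T = 1%:M)
           (FC : Pi *m C *m J *m C^T = 0).

Local Notation F := (Pi *m C).
Local Notation chartf X := (A + X *m C).
Local Notation kgramX X := (@kgram R n r s nu d J A C (chartf X)).
Local Notation kframeX X := (@kframe R n r s nu d J A C (chartf X)).
Local Notation gram11X X := (@gram11 R n r s nu d J A C (chartf X)).

(** Moves the last [nu] rows of the frame [A + X *m C] by [Y *m F]. *)
Definition kshift (X : 'M[R]_(i, d)) (Y : 'M[R]_nu) : 'M[R]_(i, d) :=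
  X + col_mx 0 (Y *m Pi).

(** Its symmetrization is the linear part of [kgram] at [X = 0]. *)
Definition cross (X : 'M[R]_(i, d)) : 'M[R]_nu :=
  dsubmx X *m C *m J *m (dsubmx A)^T.

(** The difference of [kgram] and a linear function of [X]. It is invariant
under shifts ([resid_kshift]), so that the shift by half of it is a bijection
with an explicit inverse. *)
Definition resid X : 'M[R]_nu := kgramX X - (cross X + (cross X)^T).

Definition straight X := kshift X (2^-1 *: resid X).
Definition unstraight X := kshift X (- (2^-1 *: resid X)).

Let uE X : usubmx (chartf X) = usubmx A + usubmx X *m C.
Proof. by rewrite linearD /= mul_usub_mx. Qed.

Let dE X : dsubmx (chartf X) = dsubmx A + dsubmx X *m C.
Proof. by rewrite linearD /= mul_dsub_mx. Qed.

Let uS X Y : usubmx (chartf (kshift X Y)) = usubmx (chartf X).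
Proof. by rewrite !uE /kshift linearD /= col_mxKu addr0. Qed.

Let dS X Y : dsubmx (chartf (kshift X Y)) = dsubmx (chartf X) + Y *m F.
Proof. by rewrite !dE /kshift linearD /= col_mxKd mulmxDl addrA mulmxA. Qed.

Let FM1 X : F *m J *m (usubmx (chartf X))^T = 0.
Proof. by rewrite uE linearD /= mulmxDr FE trmx_mul mulmxA FC mul0mx addr0. Qed.

Let FM2 X : F *m J *m (dsubmx (chartf X))^T = 1%:M.
Proof. by rewrite dE linearD /= mulmxDr FK trmx_mul mulmxA FC mul0mx addr0. Qed.

Lemma gram11_kshift X Y :
  gram11X (kshift X Y) = gram11X X.
Proof. by rewrite /gram11 !nframe_chart // uS. Qed.

Let YFM1 X (Y : 'M[R]_nu) : Y *m F *m J *m (usubmx (chartf X))^T = 0.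
Proof. by rewrite -!(mulmxA Y) FM1 mulmx0. Qed.

(** [F] is orthogonal to the first [r + s] rows of the frame, so that a shift by
[Y *m F] leaves their Gram matrix and the subtracted projections unchanged. *)
Lemma kframe_kshift X Y :
  kframeX (kshift X Y) = kframeX X + Y *m F.
Proof.
rewrite !kframe_decomp gram11_kshift !nframe_chart // uS dS.
by rewrite (mulmxDl _ (Y *m F)) (mulmxDl _ (Y *m F *m J)) YFM1 addr0 addrAC.
Qed.

(** The key identity. The shift is isotropic and its pairing with [kframe] is
[Y], whatever [X] is; hence the effect of a shift on [kgram] is linear. *)
Lemma kgram_kshift X Y : kgramX (kshift X Y) = kgramX X + (Y + Y^T).
Proof.
have Fk : F *m J *m (kframeX X)^T = 1%:M.
  rewrite kframe_decomp nframe_chart // linearB /= mulmxBr FM2.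
  by rewrite trmx_mul (mulmxA _ (usubmx _)^T) FM1 mul0mx subr0.
have kF : kframeX X *m J *m F^T = 1%:M.
  by apply: trmx_inj; rewrite trmx1 trmx_mul trmxK trmx_mul JT mulmxA.
have FF : F *m J *m F^T = 0 by rewrite trmx_mul mulmxA FC mul0mx.
rewrite /kgram kframe_kshift; move: (kframe _ _ _ _) Fk kF FF => k.
move: F => G Gk kG GG; rewrite linearD /= mulmxDl !mulmxDl !mulmxDr trmx_mul.
rewrite !(mulmxA _ G^T) kG mul1mx -!(mulmxA Y) Gk mulmx1 GG mul0mx mulmx0 addr0.
by rewrite -addrA (addrC Y).
Qed.

Lemma cross_kshift X Y : cross (kshift X Y) = cross X + Y.
Proof.
rewrite /cross /kshift linearD /= col_mxKd !mulmxDl.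
by rewrite -!(mulmxA Y) FK mulmx1.
Qed.

Lemma resid_kshift X Y : resid (kshift X Y) = resid X.
Proof.
rewrite /resid kgram_kshift cross_kshift [(cross X + Y)^T]linearD /=.
rewrite [cross X + Y + _]addrACA.
by rewrite [- (_ + _ + _)]opprD addrACA subrr addr0.
Qed.

Let kshiftNK X Y : kshift (kshift X Y) (- Y) = X.
Proof. by rewrite /kshift mulNmx -[0 in X in _ + X]oppr0 -opp_col_mx addrK. Qed.

Lemma straightK : cancel straight unstraight.
Proof. by move=> X; rewrite /unstraight /straight resid_kshift kshiftNK. Qed.

Lemma unstraightK : cancel unstraight straight.
Proof.
move=> X; rewrite /unstraight /straight resid_kshift.
by rewrite -{2}[2^-1 *: _]opprK kshiftNK.
Qed.

Lemma kgramT X : (kgramX X)^T = kgramX X.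
Proof. by rewrite /kgram trmx_mul trmxK trmx_mul JT mulmxA. Qed.

Lemma residT X : (resid X)^T = resid X.
Proof. by rewrite /resid linearB linearD /= trmxK kgramT (addrC (_^T)). Qed.

(** Only the entries on and above the diagonal are kept, in order to make this
linear map surjective: its kernel then has the codimension of the space of
symmetric matrices. *)
Definition symm_cross (X : 'M[R]_(i, d)) :
    {ffun {p : 'I_nu * 'I_nu | p.1 <= p.2}%N -> R^o} :=
  [ffun p => (cross X + (cross X)^T) (val p).1 (val p).2].

Lemma symm_cross_linear : linear symm_cross.
Proof.
move=> a X Y; apply/ffunP => p; rewrite !ffunE /cross.
by rewrite linearP /= !mulmxDl -!scalemxAl !mxE /GRing.scale /=; ring.
Qed.

HB.instance Definition _ := GRing.isLinear.Build _ _ _ _ _ symm_cross_linear.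

Lemma symm_cross0 X : symm_cross X = 0 <-> cross X + (cross X)^T = 0.
Proof.
split=> [/ffunP X0|X0]; last by apply/ffunP => p; rewrite !ffunE X0 mxE.
apply/matrixP => a b; rewrite [RHS]mxE.
wlog ab : a b / (a <= b)%N => [H|].
  have [|/ltnW] := leqP a b; first exact: H.
  by move=> /H <-; rewrite !mxE addrC.
by have := X0 (exist _ (a, b) ab); rewrite !ffunE.
Qed.

Lemma symm_cross_surj w : exists X, symm_cross X = w.
Proof.
(* An upper triangular preimage, with halved diagonal because the diagonal
   entries are counted twice in [Q + Q^T]. *)
pose Q : 'M[R]_nu := \matrix_(a, b)
  if insub (a, b) is Some p then (if a == b then 2^-1 else 1) * w p else 0.
exists (kshift 0 Q); apply/ffunP => p; rewrite ffunE cross_kshift.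
have -> : cross 0 = 0 by rewrite /cross linear0 !mul0mx.
rewrite add0r; case: p => -[a b] /= ab; rewrite !mxE insubT /=.
case: insubP => [p' /= ba p'E|/=].
  have eab : a = b by apply/val_inj/anti_leq; rewrite ab ba.
  have -> : p' = Sub (a, b) ab.
    by apply: val_inj; apply: etrans p'E _; rewrite SubK; congr pair.
  have -> : a == b by apply/eqP.
  have -> : b == a by apply/eqP.
  by rewrite -mulrDl -[2^-1]mul1r -splitr mul1r.
rewrite -ltnNge => lt_ab; have /negbTE-> : a != b by rewrite neq_ltn lt_ab.
by rewrite mul1r addr0.
Qed.

Definition straight_space : {vspace 'M[R]_(i, d)} := lker (linfun symm_cross).

Lemma dim_straight_space :
  (\dim straight_space + (nu * (nu + 1)) %/ 2 = i * d)%N.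
Proof.
have := limg_ker_dim (linfun symm_cross) fullv.
rewrite capfv dimvf /dim /= => <-; congr (_ + _)%N.
have -> : limg (linfun symm_cross) = fullv.
  apply/vspaceP => w; rewrite memvf.
  have [X <-] := symm_cross_surj w; rewrite -[symm_cross X]lfunE.
  exact: memv_img (memvf _).
by rewrite dimvf -card_le_pairs -[LHS]muln1.
Qed.

Lemma straight_spaceP X : (straight X \in straight_space) <-> kgramX X = 0.
Proof.
have crossE : cross (straight X) + (cross (straight X))^T = kgramX X.
  rewrite /straight cross_kshift [(cross X + _)^T]linearD linearZ /= residT.
  rewrite addrACA -scalerDl -[2^-1]mul1r -splitr scale1r.
  by rewrite /resid addrC subrK.
rewrite memv_ker lfunE /= -crossE; split; first by move/eqP/symm_cross0.
by move=> ?; apply/eqP/symm_cross0.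
Qed.

Definition gram11_unit_set : set 'M[R]_(i, d) :=
  [set X | gram11X X \in unitmx].

Lemma smooth_chartf (O : set 'M[R]_(i, d)) :
  open O -> smooth_on O (fun X => chartf X).
Proof.
move=> Oo; apply: smoothD => //; first exact: smooth_cst.
by apply: smooth_mulmx => //; [exact: smooth_id_mx|exact: smooth_cst].
Qed.

Lemma open_gram11_unit_set : open gram11_unit_set.
Proof.
have dets : smooth_on setT (fun X => \det (gram11X X) : R^o).
  apply: smooth_det; first exact: openT; apply: smooth_gram11.
  - exact: openT.
  - exact/smooth_chartf/openT.
  - by move=> X _; rewrite coef_chart // unitmx1.
rewrite (_ : gram11_unit_set =
    [set X | setT X /\ [set t | t != 0] (\det (gram11X X))]).
  by apply: smooth_open_preimage => //; exact: openT.
by apply/seteqP; split=> v /=; rewrite /gram11_unit_set /= unitmxE unitfE // => -[].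
Qed.

Let Do := open_gram11_unit_set.

Lemma smooth_kshift (Y : 'M[R]_(i, d) -> 'M[R]_nu) :
  smooth_on gram11_unit_set Y ->
  smooth_on gram11_unit_set (fun X => kshift X (Y X)).
Proof.
move=> Ys; apply: smoothD => //; first exact: smooth_id_mx.
apply: smooth_col_mx => //; first exact: smooth_cst.
by apply: smooth_mulmx => //; exact: smooth_cst.
Qed.

Lemma smooth_resid : smooth_on gram11_unit_set (fun X => 2^-1 *: resid X).
Proof.
have cs : smooth_on gram11_unit_set cross.
  do 3![apply: smooth_mulmx => //; last exact: smooth_cst].
  by apply: smooth_dsubmx => //; exact: smooth_id_mx.
apply: smoothZ => //; first exact: smooth_cst.
apply: smoothD => //; last first.
  by apply: smoothN => //; apply: smoothD => //; exact: smooth_trmx.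
apply: smooth_kgram => //; first exact: smooth_chartf.
by move=> X _; rewrite coef_chart // unitmx1.
Qed.

Lemma smooth_straight : smooth_on gram11_unit_set straight.
Proof. exact: smooth_kshift smooth_resid. Qed.

Lemma smooth_unstraight : smooth_on gram11_unit_set unstraight.
Proof. by apply: smooth_kshift; apply: smoothN => //; exact: smooth_resid. Qed.

(** No inverse function theorem is involved, as the two maps are mutually
inverse everywhere; [O] is only restricted in order to make them smooth. *)
Lemma straight_diffeo (O : set 'M[R]_(i, d)) :
  open O -> O `<=` gram11_unit_set ->
  exists O', diffeo O O' straight unstraight.
Proof.
move=> Oo OD; exists [set Z | gram11_unit_set Z /\ O (unstraight Z)].
have O'o : open [set Z | gram11_unit_set Z /\ O (unstraight Z)].
  rewrite openE => Z [DZ OZ]; rewrite /interior.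
  have DZn : nbhs Z gram11_unit_set by exact: open_nbhs_nbhs.
  have := smooth_continuous smooth_unstraight DZ.
  move=> /(_ _ (open_nbhs_nbhs (conj Oo OZ))).
  by apply: filterS2 DZn.
split=> //.
- exact: smooth_sub smooth_straight.
- by apply: smooth_sub smooth_unstraight => Z [].
- split=> [X OX|Z [DZ OZ]]; last by rewrite unstraightK.
  rewrite straightK; split=> //; split=> //=.
    by rewrite /gram11_unit_set /= gram11_kshift; exact: OD.
  by rewrite straightK.
Qed.

End Straightening.

(** * Points of the Grassmannian as row spaces *)

Section GramMatrix.
Variables (R : realType) (n : nat) (b : symform 'rV[R]_n).

Definition gram_mx : 'M[R]_n := \matrix_(k, l) b (delta_mx 0 k) (delta_mx 0 l).

Lemma symformP (V : lmodType R) (f : symform V) : is_symform f.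
Proof. by case: f => f /= /asboolP. Qed.

Lemma symform_suml (V : lmodType R) (f : symform V) m (a : 'I_m -> R) u w :
  f (\sum_k a k *: u k) w = \sum_k a k * f (u k) w.
Proof.
have [fl _] := symformP f; have f0 : f 0 w = 0.
  by have := fl (-1) 0 0 w; rewrite scaler0 addr0 mulN1r addNr.
elim: m a u => [|m IH] a u; first by rewrite !big_ord0.
by rewrite !big_ord_recl fl IH.
Qed.

Lemma symform_sumr (V : lmodType R) (f : symform V) m (a : 'I_m -> R) u w :
  f w (\sum_k a k *: u k) = \sum_k a k * f w (u k).
Proof.
have [_ fs] := symformP f; rewrite fs symform_suml.
by apply: eq_bigr => k _; rewrite fs.
Qed.

Lemma gram_mxE u v : b u v = (u *m gram_mx *m v^T) 0 0.
Proof.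
rewrite [u in LHS]row_sum_delta [v in LHS]row_sum_delta symform_suml mxE.
transitivity (\sum_k \sum_l u 0 k * gram_mx k l * v 0 l).
  apply: eq_bigr => k _; rewrite symform_sumr mulr_sumr; apply: eq_bigr => l _.
  by rewrite mxE -mulrA (mulrC (b _ _)).
rewrite exchange_big; apply: eq_bigr => l _.
by rewrite !mxE mulr_suml.
Qed.

Lemma gram_mx_row m1 m2 (B : 'M[R]_(m1, n)) (B' : 'M[R]_(m2, n)) k l :
  (B *m gram_mx *m B'^T) k l = b (row k B) (row l B').
Proof.
rewrite gram_mxE -row_mul [LHS]mxE [RHS]mxE; apply: eq_bigr => j _.
by rewrite !mxE.
Qed.

Lemma gram_mxT : gram_mx^T = gram_mx.
Proof. by apply/matrixP => k l; rewrite !mxE; apply: (symformP b).2. Qed.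

Lemma gram_mx_unit : nondegenerate_form b -> gram_mx \in unitmx.
Proof.
move=> bnd; rewrite -row_free_unit -kermx_eq0; apply/rowV0P => u /sub_kermxP uJ.
by apply: bnd => w; rewrite gram_mxE uJ mul0mx mxE.
Qed.

End GramMatrix.

Section RowSpaces.
Variables (R : realType) (n : nat).

Lemma mem_row_vs m (B : 'M[R]_(m, n)) v : (v \in row_vs B) = (v <= B)%MS.
Proof.
apply/idP/idP => [|/submxP[u ->]]; last first.
  rewrite mulmx_sum_row; apply: memv_suml => k _; apply: memvZ.
  by apply: memv_span; apply/mapP; exists k; rewrite ?mem_enum.
move=> /coord_span ->; apply: summx_sub => k _; apply: scalemx_sub.
by rewrite -tnth_nth tnth_mktuple row_sub.
Qed.

Lemma row_vs_eqmx m1 m2 (B : 'M[R]_(m1, n)) (B' : 'M[R]_(m2, n)) :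
  row_vs B = row_vs B' <-> (B :=: B')%MS.
Proof.
split=> [BB|BB]; last by apply/vspaceP => v; rewrite !mem_row_vs BB.
by apply/eqmxP/andP; split; apply/row_subP => k; rewrite -mem_row_vs;
  [rewrite -BB|rewrite BB]; rewrite mem_row_vs row_sub.
Qed.

Lemma free_rows m (B : 'M[R]_(m, n)) :
  free [tuple row k B | k < m] = row_free B.
Proof.
apply/freeP/idP => [Bf|Bf a].
  rewrite -kermx_eq0; apply/rowV0P => u /sub_kermxP uB.
  apply/rowP => k; rewrite mxE; apply: Bf.
  rewrite -[RHS]uB mulmx_sum_row; apply: eq_bigr => l _.
  by rewrite -tnth_nth tnth_mktuple.
under eq_bigr do rewrite -tnth_nth tnth_mktuple.
move=> aB k; have /(row_free_inj Bf)/rowP/(_ k) : (\row_l a l) *m B = 0 *m B.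
  by rewrite mul0mx mulmx_sum_row -[RHS]aB; apply: eq_bigr => l _; rewrite mxE.
by rewrite !mxE.
Qed.

Lemma dim_row_vs m (B : 'M[R]_(m, n)) : (\dim (row_vs B) == m) = row_free B.
Proof. by rewrite -free_rows /free size_tuple. Qed.

Lemma row_vs_change m (B B' : 'M[R]_(m, n)) :
  row_vs B = row_vs B' -> row_free B' ->
  exists2 g : 'M[R]_m, g \in unitmx & B = g *m B'.
Proof.
move=> /row_vs_eqmx BB Bf; have /submxP[g gB] : (B <= B')%MS by rewrite BB.
exists g => //; rewrite -row_free_unit /row_free -(mxrankMfree _ Bf) -gB BB.
exact: Bf.
Qed.

Variable i : nat.

(** Some frame of [y]; constructions below are made invariant under change of
frame, so that any other frame of [y] may be substituted for it. *)
Definition frame (y : Gr R i n) : 'M[R]_(i, n) :=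
  \matrix_(k < i) (vbasis y)`_k.

Lemma dim_Gr (y : Gr R i n) : \dim y = i.
Proof. by case: y => y /= /eqP. Qed.

Lemma frameK (y : Gr R i n) : row_vs (frame y) = y.
Proof.
rewrite -[RHS](span_basis (vbasisP y)); congr span.
apply: (@eq_from_nth _ 0) => [|k]; first by rewrite !size_tuple dim_Gr.
rewrite size_tuple => ki; rewrite -[k]/(nat_of_ord (Ordinal ki)) -tnth_nth.
by rewrite tnth_mktuple rowK.
Qed.

Lemma frame_free (y : Gr R i n) : row_free (frame y).
Proof. by rewrite -dim_row_vs frameK dim_Gr. Qed.

Lemma Gr_inj (y z : Gr R i n) : (y : {vspace _}) = z -> y = z.
Proof. exact: val_inj. Qed.

Lemma frame_change (y : Gr R i n) (B : 'M[R]_(i, n)) : row_vs B = y ->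
  exists2 g : 'M[R]_i, g \in unitmx & B = g *m frame y.
Proof.
rewrite -{1}[y : {vspace _}]frameK => /row_vs_change; apply.
exact: frame_free.
Qed.

Lemma Gr_act_row_vs (y : Gr R i n) (B : 'M[R]_(i, n)) (h : 'M[R]_n) :
  row_vs B = y -> h \in unitmx -> row_vs (B *m h) = Gr_act y h.
Proof.
move=> By hU; rewrite /Gr_act.
have yh : (linfun (mulmxr h) @: y)%VS = row_vs (B *m h).
  rewrite -By limg_span; congr span; rewrite /= -map_comp; apply: eq_map => k.
  by rewrite /= lfunE /= row_mul.
rewrite [RHS]val_insubd yh dim_row_vs.
rewrite /row_free mxrankMfree ?row_free_unit // -/(row_free B).
by rewrite -dim_row_vs By dim_Gr eqxx.
Qed.

End RowSpaces.

(** Trades the length [\dim {:V}] of the diagonalizing basis for a number that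
is only provably equal to it. *)
Lemma has_signatureP (R : realType) (V : vectType R) (f : symform V) r s N :
  \dim {:V} = N ->
  has_signature f r s <-> (r + s <= N)%N /\
  exists2 e : N.-tuple V, basis_of fullv e &
    forall k l, f (tnth e k) (tnth e l) =
      if k != l then 0
      else if (k < r)%N then 1
      else if (k < r + s)%N then -1 else 0.
Proof. by move=> <-. Qed.

Lemma signature_blockE (R : realType) r s nu (k l : 'I_(r + s + nu)) :
  (block_mx (sgn_mx R r s) 0 0 0 : 'M[R]_(r + s + nu)) k l =
  if k != l then 0
  else if (k < r)%N then 1
  else if (k < r + s)%N then -1 else 0.
Proof.
case: (split_ordP k) => k' ->; case: (split_ordP l) => l' ->.
- rewrite block_mxEul /sgn_mx (inj_eq (@lshift_inj _ _)) /=.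
  case: (split_ordP k') => k'' ->; case: (split_ordP l') => l'' ->.
  + by rewrite block_mxEul mxE (inj_eq (@lshift_inj _ _)) /=; case: eqP.
  + by rewrite block_mxEur mxE eq_lrshift.
  + by rewrite block_mxEdl mxE eq_rlshift.
  + rewrite block_mxEdr mxE (inj_eq (@rshift_inj _ _)) /=.
    by case: eqP.
- by rewrite block_mxEur mxE eq_lrshift.
- by rewrite block_mxEdl mxE eq_rlshift.
- rewrite block_mxEdr mxE (inj_eq (@rshift_inj _ _)) /=.
  by rewrite ltnNge -addnA leq_addr /=; case: eqP.
Qed.

Lemma sig_orbitP (R : realType) n r s nu (b : symform 'rV[R]_n)
    (y : Gr R (r + s + nu) n) :
  sig_orbit b r s y <-> exists2 B : 'M[R]_(r + s + nu, n), row_vs B = y &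
    B *m gram_mx b *m B^T = block_mx (sgn_mx R r s) 0 0 0.
Proof.
have dimy : \dim {:subvs_of y} = (r + s + nu)%N.
  by rewrite dimvf -[RHS](dim_Gr y).
rewrite /sig_orbit /=.
split=> [/(has_signatureP _ _ _ dimy)[_ [e eb eE]]|[B By BJ]].
  exists (\matrix_k vsval (tnth e k)).
    apply/eqP; rewrite eqEsubv; apply/andP; split.
      apply/span_subvP => _ /mapP[k _ ->]; rewrite rowK; exact: subvsP.
    apply/subvP => v vy; rewrite mem_row_vs -(vsprojK vy).
    have := memvf (vsproj y v); rewrite -(span_basis eb) => /coord_span ->.
    rewrite linear_sum /=; apply: summx_sub => k _.
    apply: scalemx_sub; rewrite -tnth_nth.
    by rewrite -(rowK (fun k => vsval (tnth e k))) row_sub.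
  apply/matrixP => k l; rewrite gram_mx_row !rowK signature_blockE.
  exact: eE.
apply/(has_signatureP _ _ _ dimy); split; first exact: leq_addr.
have By' k : row k B \in (y : {vspace _}) by rewrite -By mem_row_vs row_sub.
exists [tuple vsproj y (row k B) | k < r + s + nu].
  rewrite basisEfree size_tuple dimy leqnn subvf !andbT; apply/freeP => a.
  under eq_bigr do rewrite -tnth_nth tnth_mktuple.
  move=> /(congr1 vsval); rewrite linear_sum linear0 /= => aB.
  have Bf : free [tuple row k B | k < r + s + nu].
    by rewrite free_rows -dim_row_vs By dim_Gr.
  move/freeP: Bf; apply; rewrite -[RHS]aB; apply: eq_bigr => k _.
  by rewrite -tnth_nth tnth_mktuple vsprojK.
move=> k l; rewrite !tnth_mktuple -signature_blockE -BJ gram_mx_row.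
by rewrite /sigma1 /= !vsprojK.
Qed.

(** * Curves of matrices *)

Section MatrixDerivative.
Variable R : realType.

Definition is_derive_mx m n (F : R^o -> 'M[R]_(m, n)) (dF : 'M[R]_(m, n)) :
    Prop :=
  forall k l, is_derive (0 : R^o) (1 : R^o) (fun t => F t k l : R^o) (dF k l).

Lemma is_derive_mxM m n p (F : R^o -> 'M[R]_(m, n))
    (G : R^o -> 'M[R]_(n, p)) dF dG :
  is_derive_mx F dF -> is_derive_mx G dG ->
  is_derive_mx (fun t => F t *m G t) (dF *m G 0 + F 0 *m dG).
Proof.
move=> Fd Gd k l.
rewrite (_ : (fun _ => _) =
    \sum_j ((fun t => F t k j : R^o) * (fun t => G t j l : R^o))); last first.
  by apply/funext => t; rewrite fct_sumE mxE.
have Hj j : is_derive (0 : R^o) (1 : R^o)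
    ((fun t => F t k j : R^o) * (fun t => G t j l : R^o))
    (F 0 k j * dG j l + G 0 j l * dF k j).
  exact: is_deriveM.
apply: is_derive_eq (is_derive_sum Hj) _.
rewrite !mxE -big_split; apply: eq_bigr => j _ /=.
by rewrite addrC (mulrC (G 0 j l)).
Qed.

Lemma is_derive_mx_cst m n (F : 'M[R]_(m, n)) : is_derive_mx (fun=> F) 0.
Proof. by move=> k l; rewrite mxE; exact: is_derive_cst. Qed.

Lemma is_derive_mx_tr m n (F : R^o -> 'M[R]_(m, n)) dF :
  is_derive_mx F dF -> is_derive_mx (fun t => (F t)^T) dF^T.
Proof. by move=> Fd k l; rewrite mxE; under eq_fun do rewrite mxE; exact: Fd. Qed.

Lemma is_derive_mx_affine m n (F G : 'M[R]_(m, n)) :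
  is_derive_mx (fun t => F + t *: G) G.
Proof.
move=> k l; under eq_fun do rewrite !mxE.
have -> : (fun t : R^o => F k l + t * G k l : R^o) =
  cst (F k l : R^o) + ((id : R^o -> R^o) * cst (G k l : R^o)) by [].
have cd a := is_derive_cst (a : R^o) (0 : R^o) (1 : R^o).
have H := is_deriveM (is_derive_id (0 : R^o) 1) (cd (G k l)).
apply: is_derive_eq (is_deriveD (cd (F k l)) H) _.
by rewrite scaler0 !add0r /GRing.scale /= mulr1.
Qed.

Lemma smooth_is_derive_mx m n (O : set R^o) (F : R^o -> 'M[R]_(m, n)) :
  open O -> smooth_on O F -> O 0 -> exists dF, is_derive_mx F dF.
Proof.
move=> Oo Fs O0; exists (\matrix_(k, l) 'D_1 (fun t => F t k l : R^o) (0 : R^o)).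
move=> k l; rewrite mxE; apply: derivableP; apply: diff_derivable.
by have [+ _] := (smooth_mxP Oo F).1 Fs k l 1%N; apply.
Qed.

End MatrixDerivative.

(** * The subbundle near a point of the orbit *)

Section GrassmannChart.
Variables (R : realType) (n r s nu : nat).
Local Notation i := (r + s + nu)%N.
Variables (b : symform 'rV[R]_n) (c : chart R i n).
Local Notation J := (gram_mx b).
Local Notation A := (chart_frame c).
Local Notation C := (chart_coframe c).
Local Notation JT := (gram_mxT b).
Implicit Types (y z : Gr R i n) (B : 'M[R]_(i, n)).

Definition admissibleGr : set (Gr R i n) := [set y | admissible J A C (frame y)].

Definition kframeGr (y : Gr R i n) : 'M[R]_(nu, n) := kframe J A C (frame y).

(** The fibre of the subbundle at [y]: the orthogonal complement in [y] of the
first [r + s] vectors of its normalized frame. *)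
Definition kspace (y : Gr R i n) : {vspace 'rV[R]_n} := row_vs (kframeGr y).

Lemma admissibleGrP y B : row_vs B = y -> admissibleGr y <-> admissible J A C B.
Proof.
move=> /frame_change[g gU ->]; split=> [|Bg]; first exact: admissibleM.
suff: admissible J A C (invmx g *m (g *m frame y)) by rewrite mulKmx.
by apply: admissibleM => //; rewrite unitmx_inv.
Qed.

Lemma admissibleGr_coef y : admissibleGr y -> coef A C (frame y) \in unitmx.
Proof. by case. Qed.

Lemma kframeGrE y B :
  row_vs B = y -> admissible J A C B -> kframeGr y = kframe J A C B.
Proof.
move=> By Bg; have /(admissibleGrP By)/admissibleGr_coef yU := Bg.
by have [g gU ->] := frame_change By; rewrite kframeM.
Qed.

Lemma smooth_chart (c' : chart R i n) (O : set 'M[R]_(i, n - i)) : open O ->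
  smooth_on O (fun X => chart_frame c' + X *m chart_coframe c').
Proof.
move=> Oo; apply: smoothD => //; first exact: smooth_cst.
by apply: smooth_mulmx => //; [exact: smooth_id_mx|exact: smooth_cst].
Qed.

Lemma admissibleGr_chart (c' : chart R i n) X :
  admissibleGr (chart_param c' X) <->
  admissible J A C (chart_frame c' + X *m chart_coframe c').
Proof. exact: admissibleGrP. Qed.

Lemma open_admissibleGr : open admissibleGr.
Proof.
move=> c'; rewrite (_ : _ @^-1` _ = [set X | setT X /\
    admissible J A C (chart_frame c' + X *m chart_coframe c')]).
  by apply: open_admissible; [exact: openT|exact/smooth_chart/openT].
apply/seteqP; split=> X /=; first by move/admissibleGr_chart.
by case=> _ /admissibleGr_chart.
Qed.

Lemma smooth_kframeGr : Gr_smooth admissibleGr kframeGr.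
Proof.
move=> c'; have Oo : open (chart_param c' @^-1` admissibleGr) by exact: open_admissibleGr.
apply: (@smooth_ext _ _ _ Oo _
    (fun X => kframe J A C (chart_frame c' + X *m chart_coframe c'))).
  by move=> X /= /admissibleGr_chart Xg; rewrite (kframeGrE _ Xg).
apply: smooth_kframe => //; first exact: smooth_chart.
  by move=> X /= /admissibleGr_chart[].
by move=> X /= /admissibleGr_chart/admissible_unit; apply; exact: gram_mxT.
Qed.

Lemma kspace_sub y : (kspace y <= y)%VS.
Proof.
apply/subvP => v; rewrite -(frameK y) !mem_row_vs.
by move/submx_trans; apply; exact: kframe_sub.
Qed.

Lemma kframeGr_free y : admissibleGr y -> row_free (kframeGr y).
Proof. by move=> yg; apply: kframe_free; exact: admissibleGr_coef. Qed.

Lemma kspace_null y v : admissibleGr y -> null_space (sigma1 b y) v ->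
  vsval v \in kspace y.
Proof.
move=> yg vn; rewrite mem_row_vs; apply: null_sub_kframe => //.
- exact: gram_mxT.
- by rewrite -mem_row_vs frameK subvsP.
apply/matrixP => k l; rewrite gram_mx_row [RHS]mxE.
have rl : row l (frame y) \in (y : {vspace _}) by rewrite -frameK mem_row_vs row_sub.
have := vn (vsproj y (row l (frame y))); rewrite /sigma1 /= vsprojK // => <-.
by congr (b _ _); apply/rowP => j; rewrite !ord1 mxE.
Qed.

Lemma subbundle_kspace : smooth_subbundle admissibleGr kspace nu.
Proof.
split=> y yg.
  by split; [exact: kspace_sub|apply/eqP; rewrite dim_row_vs kframeGr_free].
exists admissibleGr, (fun k z => vsproj (kspace z) (row k (kframeGr z))).
have rk k z : row k (kframeGr z) \in kspace z by rewrite mem_row_vs row_sub.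
have rE k z : vsval (vsproj (kspace z) (row k (kframeGr z))) = row k (kframeGr z).
  exact: vsprojK.
split=> //.
- by split=> //; exact: open_admissibleGr.
- move=> k c'; have Oo : open (chart_param c' @^-1` admissibleGr) by exact: open_admissibleGr.
  apply: smooth_ext (smooth_row Oo k (smooth_kframeGr c')) => // X _ /=.
  by rewrite rE.
- move=> z zg; rewrite (_ : [tuple _ | _ < _] = [tuple row k (kframeGr z) | k < nu]).
    rewrite basisEdim subvv size_tuple /=.
    have /eqP -> : \dim (kspace z) == nu by rewrite dim_row_vs kframeGr_free.
    exact: leqnn.
  by apply/eq_from_tnth => k; rewrite !tnth_mktuple rE.
Qed.

Definition kgramGr y : 'M[R]_nu := kgram J A C (frame y).

Lemma kgramGr_entry y k l :
  kgramGr y k l = b (row k (kframeGr y)) (row l (kframeGr y)).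
Proof. by rewrite -gram_mx_row. Qed.

Lemma admissibleGr_sigP y : admissibleGr y -> sig_orbit b r s y <-> kgramGr y = 0.
Proof.
move=> yg; rewrite /kgramGr -(admissible_sigP JT (frame_free y) yg) sig_orbitP.
split=> -[B By BJ]; exists B => //; first by apply/row_vs_eqmx; rewrite By frameK.
by rewrite -[RHS]frameK; apply/row_vs_eqmx.
Qed.

End GrassmannChart.

(** * Sections of the bundle of symmetric forms *)

Section S2Sections.
Variables (R : realType) (n i : nat) (Et : Gr R i n -> {vspace 'rV[R]_n}).
Variable U : set (Gr R i n).

Lemma symformD (V : lmodType R) (f g : symform V) u v : (f + g) u v = f u v + g u v.
Proof. by []. Qed.

Lemma symform_sum (V : lmodType R) I (t : seq I) (f : I -> symform V) u v :
  (\sum_(k <- t) f k) u v = \sum_(k <- t) f k u v.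
Proof. by elim: t => [|k t IH]; rewrite ?big_nil // !big_cons symformD IH. Qed.

Lemma symform_ext (V : lmodType R) (f g : symform V) :
  (forall u v, f u v = g u v) -> f = g.
Proof. by move=> fg; apply/val_inj/funext => u; apply/funext => v; exact: fg. Qed.

Definition restr_form (g : symform 'rV[R]_n) (y : Gr R i n) : S2_fiber Et y :=
  symform_pull vsval g.

Lemma S2_section_restr g : @S2_section R i n Et U (restr_form g).
Proof.
move=> U' e f U'o _ es fs c; have Oo : open (chart_param c @^-1` U') by exact: U'o.
have := smooth_mulmx Oo (smooth_mulmx Oo (es c) (smooth_cst _ (gram_mx g)))
  (smooth_trmx Oo (fs c)).
move/(smooth_mxP Oo) => /(_ 0 0); apply: smooth_ext => // X _ /=.
by rewrite [RHS]gram_mxE.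
Qed.

Lemma S2_section0 : @S2_section R i n Et U (fun=> 0).
Proof.
move=> U' e f U'o _ _ _ c; have Oo : open (chart_param c @^-1` U') by exact: U'o.
by apply: smooth_ext (smooth_cst _ (0 : R^o)).
Qed.

Lemma S2_sectionD s t : @S2_section R i n Et U s -> @S2_section R i n Et U t ->
  @S2_section R i n Et U (fun z => s z + t z).
Proof.
move=> ss ts U' e f U'o U'U es fs c.
have Oo : open (chart_param c @^-1` U') by exact: U'o.
exact: smoothD (ss U' e f U'o U'U es fs c) (ts U' e f U'o U'U es fs c).
Qed.

Lemma S2_sectionZ (h : Gr R i n -> R^o) s : Gr_smooth U h ->
  @S2_section R i n Et U s -> @S2_section R i n Et U (fun z => h z *: s z).
Proof.
move=> hs ss U' e f U'o U'U es fs c.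
have Oo : open (chart_param c @^-1` U') by exact: U'o.
apply: smoothM (ss U' e f U'o U'U es fs c) => //.
by apply: smooth_sub (hs c) => X; exact: U'U.
Qed.

Variable nabla : 'M[R]_n -> (forall y, S2_fiber Et y) -> (forall y, S2_fiber Et y).
Hypothesis nablaP : linear_connection (@S2_section R i n Et) U nabla.
Variables (I : Type) (h : I -> Gr R i n -> R^o) (om : I -> symform 'rV[R]_n).
Hypothesis hs : forall k, Gr_smooth U (h k).

Let comb t : forall z, S2_fiber Et z :=
  fun z => \sum_(k <- t) h k z *: restr_form (om k) z.

Let comb_nil : comb [::] = fun=> 0.
Proof. by apply: functional_extensionality_dep => z; rewrite /comb big_nil. Qed.

Let comb_cons k t :
  comb (k :: t) = fun z => h k z *: restr_form (om k) z + comb t z.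
Proof. by apply: functional_extensionality_dep => z; rewrite /comb big_cons. Qed.

Lemma S2_section_comb t :
  @S2_section R i n Et U (fun z => \sum_(k <- t) h k z *: restr_form (om k) z).
Proof.
elim: t => [|k t IH].
  rewrite -/(comb _) comb_nil; exact: S2_section0.
rewrite -/(comb _) comb_cons; apply: S2_sectionD => //.
by apply: S2_sectionZ => //; exact: S2_section_restr.
Qed.

(** At a common zero of the coefficients only their derivatives survive in the
Leibniz rule, so the value does not depend on the connection. *)
Lemma connection_at_zero L y t : U y -> (forall k, h k y = 0) ->
  nabla L (fun z => \sum_(k <- t) h k z *: restr_form (om k) z) y =
  \sum_(k <- t) Gr_deriv L (h k) y *: restr_form (om k) y.
Proof.
move=> Uy h0; elim: t => [|k t IH].
  rewrite -/(comb _) comb_nil.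
  have := connectionD nablaP L S2_section0 S2_section0 Uy.
  have -> : (fun z => 0 + 0) = (fun=> 0) :> (forall z, S2_fiber Et z).
    by apply: functional_extensionality_dep => z; rewrite addr0.
  by rewrite big_nil => /eqP; rewrite -subr_eq0 opprD addNKr oppr_eq0 => /eqP.
rewrite -/(comb _) comb_cons.
have ks : @S2_section R i n Et U (fun z => h k z *: restr_form (om k) z).
  by apply: S2_sectionZ => //; exact: S2_section_restr.
rewrite (connectionD nablaP L ks (S2_section_comb t) Uy) IH big_cons.
rewrite (connection_Leibniz nablaP L (hs k) (S2_section_restr _) Uy).
by rewrite h0 scale0r addr0.
Qed.

End S2Sections.

(** * The restricted form is a defining section *)

Section KernelForm.
Variables (R : realType) (n r s nu : nat).
Local Notation i := (r + s + nu)%N.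
Variables (b : symform 'rV[R]_n) (c : chart R i n).
Hypothesis b_nondeg : nondegenerate_form b.
Local Notation J := (gram_mx b).
Local Notation A := (chart_frame c).
Local Notation C := (chart_coframe c).
Local Notation U := (admissibleGr b c).
Implicit Types (y z : Gr R i n).

(** Coordinates with respect to [kframeGr], for all [y] in [U] at once. *)
Definition kcoord (v : 'rV[R]_n) : 'rV[R]_nu :=
  v *m rsubmx (lsubmx (pinvmx (col_mx A C))).

Lemma kcoord_kframe y (w : 'rV[R]_nu) : U y -> kcoord (w *m kframeGr b c y) = w.
Proof.
move=> [yU _]; rewrite /kcoord -mulmxA mulmx_rsub mulmx_lsub.
by rewrite kframe_coord // ?mulmx1 //; exact: chart_free.
Qed.

(** The symmetric product of two coordinate forms. These constant forms
span the fibres of the bundle of symmetric forms over [U], so that they turn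
sections into families of functions. *)
Definition dual_pair_fun (p : 'I_nu * 'I_nu) (u v : 'rV[R]_n) : R^o :=
  2^-1 * (kcoord u 0 p.1 * kcoord v 0 p.2 + kcoord v 0 p.1 * kcoord u 0 p.2).

Lemma dual_pair_subproof p : dual_pair_fun p \in @symform_pred R 'rV[R]_n.
Proof.
apply/asboolP; split=> [a u v w|u v]; rewrite /dual_pair_fun.
  by rewrite /kcoord !mulmxDl -!scalemxAl !mxE; ring.
by rewrite addrC.
Qed.

Definition dual_pair p : symform 'rV[R]_n := SymForm (dual_pair_subproof p).

Definition kvec y (k : 'I_nu) : subvs_of (kspace b c y) :=
  vsproj _ (row k (kframeGr b c y)).

Lemma kvecE y k : vsval (kvec y k) = row k (kframeGr b c y).
Proof. by apply: vsprojK; rewrite mem_row_vs row_sub. Qed.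

Lemma kspace_expand y (u : subvs_of (kspace b c y)) : U y ->
  u = \sum_k kcoord (vsval u) 0 k *: kvec y k.
Proof.
move=> yU; apply/val_inj => /=; have := subvsP u; rewrite mem_row_vs => /submxP[w uw].
rewrite linear_sum /= uw kcoord_kframe // mulmx_sum_row.
by apply: eq_bigr => k _; rewrite /= kvecE.
Qed.

(** The sum runs over all ordered pairs, both halves of which contribute
equally because [g] is symmetric. *)
Lemma S2_fiber_expand y (g : S2_fiber (kspace b c) y) : U y ->
  g = \sum_(p <- enum {: 'I_nu * 'I_nu}) g (kvec y p.1) (kvec y p.2) *:
        restr_form (kspace b c) (dual_pair p) y.
Proof.
move=> yU; apply: symform_ext => u v; rewrite symform_sum big_enum /=.
pose x k l := kcoord (vsval u) 0 k * kcoord (vsval v) 0 l : R.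
pose h k l := g (kvec y k) (kvec y l) : R.
have gE : g u v = \sum_k \sum_l h k l * x k l.
  rewrite {1}(kspace_expand u yU) {1}(kspace_expand v yU) symform_suml.
  apply: eq_bigr => k _; rewrite symform_sumr mulr_sumr.
  by apply: eq_bigr => l _; rewrite /h /x; ring.
transitivity (\sum_k \sum_l h k l * (2^-1 * (x k l + x l k))); last first.
  rewrite pair_big /=; apply: eq_bigr => p _.
  rewrite [RHS](_ : _ = h p.1 p.2 * dual_pair_fun p (vsval u) (vsval v)) //.
  by congr (_ * (_ * (_ + _))); exact: mulrC.
have gE' : g u v = \sum_k \sum_l h k l * x l k.
  rewrite gE exchange_big; apply: eq_bigr => k _; apply: eq_bigr => l _.
  by rewrite /h ((symformP g).2).
have -> : g u v = 2^-1 * (g u v + g u v) by field.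
rewrite {1}gE gE' -big_split mulr_sumr; apply: eq_bigr => k _ /=.
rewrite -big_split mulr_sumr; apply: eq_bigr => l _ /=.
by ring.
Qed.

Lemma S2_restr_kspace :
  S2_restr (kspace b c) (sigma1 b) = restr_form (kspace b c) b.
Proof.
apply: functional_extensionality_dep => y; apply: symform_ext => u v.
rewrite /S2_restr /sigma1 /= !vsprojK //; apply: (subvP (kspace_sub b c y));
  exact: subvsP.
Qed.

Lemma restr_form_kvec y k l :
  restr_form (kspace b c) b y (kvec y k) (kvec y l) = kgramGr b c y k l.
Proof. by rewrite kgramGr_entry /= !kvecE. Qed.

Lemma smooth_kgramGr k l : Gr_smooth U (fun y => kgramGr b c y k l : R^o).
Proof.
move=> c'; have Oo : open (chart_param c' @^-1` U) by exact: open_admissibleGr.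
have ks := @smooth_kframeGr R n r s nu b c c'.
have := smooth_mulmx Oo (smooth_mulmx Oo ks (smooth_cst _ J)) (smooth_trmx Oo ks).
by move/(smooth_mxP Oo) => /(_ k l).
Qed.

(** Where [kgramGr] vanishes, the fibre of the subbundle consists of null
vectors: it is orthogonal to itself and, by construction, to its complement
in [y]. *)
Lemma kframe_null y : U y -> kgramGr b c y = 0 ->
  kframeGr b c y *m J *m (frame y)^T = 0.
Proof.
move=> yU k0; have [BU _] := yU.
have GU : gram11 J A C (frame y) \in unitmx by apply: admissible_unit yU; exact: gram_mxT.
have kM1 := kframe_orth GU; set N := nframe A C (frame y).
have kN : kframeGr b c y *m J *m N^T = 0.
  have M2E : dsubmx N = kframeGr b c y + (dsubmx N *m J *m (usubmx N)^T
      *m invmx (gram11 J A C (frame y))) *m usubmx N.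
    by rewrite /kframeGr kframe_decomp subrK.
  rewrite -[N]vsubmxK tr_col_mx mul_mx_row kM1 M2E linearD /= mulmxDr.
  rewrite [X in _ + _ *m X]trmx_mul (mulmxA _ _^T) kM1 mul0mx addr0.
  by rewrite -[_ *m _^T]/(kgramGr b c y) k0 row_mx0.
have -> : frame y = coef A C (frame y) *m N by rewrite mulKVmx.
by rewrite trmx_mul mulmxA kN mul0mx.
Qed.

(** Along the curve [y (1 + t L)] the frame is [kcoef] times the transported frame
[B (1 + t L)] of [y]. The derivative of [kcoef] contributes a variation of the
frame inside [y], which is not seen by the form at first order since the rows
of [kframeGr] are null vectors at [y]; what is left is the variation
[kframeGr *m L]. *)
Lemma Gr_deriv_kgramGr y (L : 'M[R]_n) k l : U y -> kgramGr b c y = 0 ->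
  Gr_deriv L (fun z => kgramGr b c z k l : R^o) y =
  (kframeGr b c y *m L *m J *m (kframeGr b c y)^T
   + kframeGr b c y *m J *m (kframeGr b c y *m L)^T) k l.
Proof.
move=> yU k0; pose B := frame y; pose Bt (t : R^o) := B + t *: (B *m L).
have BtE t : Bt t = B *m (1%:M + t *: L).
  by rewrite mulmxDr mulmx1 -scalemxAr.
have Lts : smooth_on setT (fun t : R^o => 1%:M + t *: L : 'M[R]_n).
  apply: smoothD; [exact: openT|exact: smooth_cst|].
  by apply: smoothZ; [exact: openT|exact/smooth_idR/openT|exact: smooth_cst].
have Bts : smooth_on setT Bt.
  apply: smoothD; [exact: openT|exact: smooth_cst|].
  by apply: smoothZ; [exact: openT|exact/smooth_idR/openT|exact: smooth_cst].
pose O1 : set R^o :=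
  [set t | setT t /\ [set x : R | x != 0] (\det (1%:M + t *: L))].
have O1o : open O1.
  apply: smooth_open_preimage; [exact: openT|exact: open_neq|].
  by apply: smooth_det Lts; exact: openT.
pose O : set R^o := [set t | O1 t /\ admissible J A C (Bt t)].
have Oo : open O by apply: open_admissible => //; apply: smooth_sub Bts => t.
have B0 : Bt 0 = B by rewrite /Bt scale0r addr0.
have O0 : O 0.
  split; last by rewrite B0.
  by split=> //=; rewrite scale0r addr0 det1 oner_neq0.
have [da daP] : exists da, is_derive_mx (fun t => kcoef J A C (Bt t)) da.
  apply: (smooth_is_derive_mx Oo _ O0); apply: smooth_kcoef => //.
  - by apply: smooth_sub Bts => t.
  - by move=> t [_ []].
  - by move=> t [_ /admissible_unit]; apply; exact: gram_mxT.
have dB : is_derive_mx Bt (B *m L) by exact: is_derive_mx_affine.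
have dk := is_derive_mxM daP dB.
have dg := is_derive_mxM (is_derive_mxM dk (is_derive_mx_cst J))
  (is_derive_mx_tr dk).
have := dg k l; rewrite /= !B0 mulmx0 addr0 => dgkl.
rewrite /Gr_deriv derive1E.
have ev : \forall t \near (0 : R^o),
    kgram J A C (Bt t) k l = kgramGr b c (Gr_act y (1%:M + t *: L)) k l :> R^o.
  apply: filterS (open_nbhs_nbhs (conj Oo O0)) => t [[_ dt] tg].
  have hU : 1%:M + t *: L \in unitmx by rewrite unitmxE unitfE.
  have E := Gr_act_row_vs (frameK y) hU.
  rewrite kgramGr_entry (kframeGrE E) -?BtE //.
  by rewrite -gram_mx_row.
rewrite -(near_eq_derive _ ev).
rewrite (_ : (fun t => _) = (fun t => (kcoef J A C (Bt t) *m Bt t *m J *m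
   (kcoef J A C (Bt t) *m Bt t)^T) k l : R^o)) //.
case: dgkl => _ ->.
have kn := kframe_null yU k0.
have kn' : B *m J *m (kframeGr b c y)^T = 0.
  by apply: trmx_inj; rewrite trmx0 trmx_mul trmxK trmx_mul gram_mxT mulmxA.
rewrite -[kcoef J A C B *m B]/(kframeGr b c y) mulmxA.
rewrite -[kcoef J A C B *m B]/(kframeGr b c y).
congr (_ k l).
move: (kframeGr b c y) kn kn' => e kn kn'.
rewrite !mulmxDl linearD /= mulmxDr -(mulmxA da B J) -(mulmxA da) kn' mulmx0.
by rewrite [(da *m B)^T]trmx_mul (mulmxA _ B^T) kn mul0mx !add0r.
Qed.

(** Non-degeneracy of [b] provides surjectivity: [L] can be chosen to move the
vectors of the frame to vectors [W] with arbitrary products with them. Taking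
these products to be half of the prescribed symmetric matrix makes the
derivative equal to that matrix. *)
Lemma defining_kspace N : (forall y, U y -> N y -> kgramGr b c y = 0) ->
  defining_section (@S2_section R i n (kspace b c)) U N
    (S2_restr (kspace b c) (sigma1 b)).
Proof.
move=> N0; rewrite S2_restr_kspace; split; first exact: S2_section_restr.
move=> y yU /(N0 _ yU) k0.
have s0 : restr_form (kspace b c) b y = 0.
  rewrite [LHS](S2_fiber_expand _ yU) big1 // => p _.
  by rewrite restr_form_kvec k0 mxE scale0r.
split=> // nabla nablaP g.
pose T : 'M[R]_nu := \matrix_(k, l) g (kvec y k) (kvec y l).
have TT : T^T = T by apply/matrixP => k l; rewrite !mxE; apply: (symformP g).2.
set e := kframeGr b c y.
have ef : row_free e by exact: kframeGr_free.
have eJf : row_free (e *m J).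
  by rewrite /row_free mxrankMfree // row_free_unit gram_mx_unit.
pose W := (2^-1 *: T) *m (pinvmx (e *m J))^T.
pose L := pinvmx e *m W; exists L.
have eL : e *m L = W by rewrite /L mulmxA mulmxVp // mul1mx.
have WJ : W *m J *m e^T = 2^-1 *: T.
  rewrite -mulmxA -[J *m e^T]trmxK trmx_mul trmxK gram_mxT /W -mulmxA -trmx_mul.
  by rewrite mulmxVp // trmx1 mulmx1.
have eJW : e *m J *m W^T = 2^-1 *: T.
  apply: trmx_inj; rewrite trmx_mul trmxK trmx_mul gram_mxT mulmxA WJ.
  by rewrite linearZ /= TT.
have sE z : U z -> restr_form (kspace b c) b z =
    \sum_(p <- enum {: 'I_nu * 'I_nu}) (kgramGr b c z p.1 p.2 : R^o) *:
      restr_form (kspace b c) (dual_pair p) z.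
  move=> zU; rewrite [LHS](S2_fiber_expand _ zU); apply: eq_bigr => p _.
  by rewrite restr_form_kvec.
have hs (p : 'I_nu * 'I_nu) : Gr_smooth U (fun z => kgramGr b c z p.1 p.2 : R^o).
  exact: smooth_kgramGr.
rewrite (connection_ext nablaP L _ _ sE yU); first last.
- exact: S2_section_comb.
- exact: S2_section_restr.
rewrite (connection_at_zero nablaP dual_pair hs) //; last first.
  by move=> p; rewrite k0 mxE.
rewrite [RHS](S2_fiber_expand _ yU); apply: eq_bigr => p _; congr (_ *: _).
rewrite Gr_deriv_kgramGr // -/e eL WJ eJW -scalerDl -[2^-1]mul1r -splitr scale1r.
by rewrite mxE.
Qed.

End KernelForm.

(** * The orbit and the theorem *)

Section Orbit.
Variables (R : realType) (n r s nu : nat).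
Local Notation i := (r + s + nu)%N.
Variables (b : symform 'rV[R]_n).
Hypothesis b_nondeg : nondegenerate_form b.
Hypothesis le_in : (i <= n)%N.
Local Notation J := (gram_mx b).
Implicit Types (x y z : Gr R i n).

(** The conditions under which the chart straightens the orbit: [chart_frame]
diagonalizes the form on the centre of the chart, and [Pi] extracts from
[chart_coframe] an isotropic family dual to the null vectors of the centre. *)
Definition adapted (c : chart R i n) (Pi : 'M[R]_(nu, n - i)) : Prop :=
  let A := chart_frame c in let C := chart_coframe c in
  [/\ A *m J *m A^T = block_mx (sgn_mx R r s) 0 0 0,
      Pi *m C *m J *m (usubmx A)^T = 0,
      Pi *m C *m J *m (dsubmx A)^T = 1%:M & Pi *m C *m J *m C^T = 0].

Lemma exists_adapted y : sig_orbit b r s y ->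
  exists (c : chart R i n) (Pi : 'M[R]_(nu, n - i)),
    adapted c Pi /\ row_vs (chart_frame c) = y.
Proof.
move=> /sig_orbitP[A Ay AJ].
have Af : row_free A by rewrite -dim_row_vs Ay dim_Gr.
have [C [Pi [ACf FE FK FC]]] := adapted_coframe (gram_mxT b)
  (gram_mx_unit b_nondeg) Af (esym (subnKC le_in)) AJ.
by exists (Chart ACf), Pi.
Qed.

Lemma chart_param0 (c : chart R i n) y :
  row_vs (chart_frame c) = y -> chart_param c 0 = y.
Proof. by move=> cy; apply: Gr_inj; rewrite /= mul0mx addr0. Qed.

Lemma adapted_admissible c Pi : adapted c Pi ->
  admissible J (chart_frame c) (chart_coframe c) (chart_frame c).
Proof.
case=> AJ _ _ _; have := admissible_chart J (chart_free c) 0.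
rewrite mul0mx addr0 => ->; have := congr1 ulsubmx AJ; rewrite block_mxKul.
rewrite -[chart_frame c in X in X -> _]vsubmxK tr_col_mx mul_col_mx.
rewrite mul_col_row block_mxKul => ->.
by move=> k l; rewrite subrr normr0 invr_gt0 ltr0n.
Qed.

(** Each point of the orbit is given its own chart, adapted to this point, where
the equation of the orbit is linear after [straight]. *)
Lemma submanifold_sig_orbit (U : set (Gr R i n)) : open U ->
  submanifold ((nu * (nu + 1)) %/ 2) (U `&` sig_orbit b r s).
Proof.
move=> Uo y [Uy sy]; have [c [Pi [cP cy]]] := exists_adapted sy.
have [AJ FE FK FC] := cP; have JT := gram_mxT b; have cf := chart_free c.
pose O := chart_param c @^-1` (U `&` admissibleGr b c).
have Oo : open O.
  by rewrite /O preimage_setI; apply: openI; [exact: Uo|exact: open_admissibleGr].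
have OD : O `<=` gram11_unit_set J (chart_frame c) (chart_coframe c).
  by move=> X [_ /admissibleGr_chart/admissible_unit]; apply.
have [V OV] := straight_diffeo JT cf FE FK FC Oo OD.
exists c, O, V, (straight J (chart_frame c) (chart_coframe c) Pi),
  (unstraight J (chart_frame c) (chart_coframe c) Pi),
  (straight_space J (chart_frame c) (chart_coframe c)); split=> //.
- exists 0; last exact: chart_param0.
  split=> /=; first by rewrite (chart_param0 cy).
  by rewrite (chart_param0 cy); apply/(admissibleGrP _ _ cy); exact: adapted_admissible cP.
- exact: dim_straight_space FK.
- move=> X [UX gX]; rewrite straight_spaceP //.
  have /admissibleGr_chart gX' := gX.
  have -> : kgram J (chart_frame c) (chart_coframe c)
      (chart_frame c + X *m chart_coframe c) = kgramGr b c (chart_param c X).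
    have E : row_vs (chart_frame c + X *m chart_coframe c) = chart_param c X by [].
    apply/matrixP => k l; rewrite kgramGr_entry (kframeGrE E gX').
    by rewrite -gram_mx_row.
  by rewrite -admissibleGr_sigP //; split=> [[]|].
Qed.

Lemma SO_gram h : SO b h -> h \in unitmx /\ h *m J *m h^T = J.
Proof.
case=> dh bh; split; first by rewrite unitmxE dh unitr1.
apply/matrixP => k l; rewrite gram_mx_row !rowE bh.
by rewrite mxE.
Qed.

Lemma sig_orbit_act y h : SO b h -> sig_orbit b r s y ->
  sig_orbit b r s (Gr_act y h).
Proof.
move=> /SO_gram[hU hJ] /sig_orbitP[B By BJ]; apply/sig_orbitP.
exists (B *m h); first exact: Gr_act_row_vs.
by rewrite -BJ trmx_mul mulmxA -!(mulmxA B) hJ mulmxA.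
Qed.

(** The group preserves signatures, so it suffices that the set of matrices [h]
moving [y] into the open set is open. *)
Lemma orbit_open_admissible (c : chart R i n) :
  orbit_open b r s (admissibleGr b c `&` sig_orbit b r s).
Proof.
split=> [y []//|y sy].
pose D : set 'M[R]_n := [set h | setT h /\ [set t | t != 0] (\det h)].
have Do : open D.
  apply: smooth_open_preimage; [exact: openT|exact: open_neq|].
  by apply: smooth_det; [exact: openT|exact/smooth_id_mx/openT].
have Bs : smooth_on D (fun h => frame y *m h).
  by apply: smooth_mulmx => //; [exact: smooth_cst|exact: smooth_id_mx].
exists [set h | D h /\ admissible J (chart_frame c) (chart_coframe c) (frame y *m h)].
  exact: open_admissible.
move=> h hSO; have [hU _] := SO_gram hSO.
have E := Gr_act_row_vs (frameK y) hU.
split=> [[/(admissibleGrP _ _ E) hg _]|[_ /(admissibleGrP _ _ E) hg]].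
  by split=> //; split=> //=; rewrite -unitfE -unitmxE.
by split=> //; exact: sig_orbit_act.
Qed.

End Orbit.

Theorem theorem3p5 (R : realType) (n p q i r s : nat) (hn : n = (p + q)%N)
    (b : symform 'rV[R]_n) (b_nondeg : nondegenerate_form b)
    (b_sign : has_signature b p q)
    (hi : (1 <= i <= n - 1)%N) (hr : (0 <= r <= p)%N) (hs : (0 <= s <= q)%N)
    (hrs : (r + s < i)%N) (x : Gr R i n) (hx : sig_orbit b r s x) :
  let nu := (i - r - s)%N in
  exists (U Ubar : set (Gr R i n)) (Et : Gr R i n -> {vspace 'rV[R]_n}),
    [/\ open_nbhs x U,
        [/\ orbit_open b r s Ubar, Ubar x & Ubar `<=` U `&` sig_orbit b r s],
        smooth_subbundle U Et nu,
        forall y, U y -> forall v : subvs_of y,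
          null_space (sigma1 b y) v -> vsval v \in Et y &
        submanifold ((nu * (nu + 1)) %/ 2) Ubar /\
        defining_section (@S2_section R i n Et) U Ubar
          (S2_restr Et (sigma1 b))].
Proof.
move=> nu; have iE : i = (r + s + nu)%N by rewrite /nu -subnDA subnKC // ltnW.
have le_in : (i <= n)%N by case/andP: hi => _ /leq_trans; apply; exact: leq_subr.
move: nu iE => nu iE; clear hi hrs; subst i.
have [c [Pi [cP cx]]] := exists_adapted b_nondeg le_in hx.
have gx : admissibleGr b c x by apply/(admissibleGrP _ _ cx); exact: adapted_admissible cP.
(* A single chart, adapted to [x], defines the neighborhood and the subbundle. *)
exists (admissibleGr b c), (admissibleGr b c `&` sig_orbit b r s), (kspace b c); split.
- by split=> //; exact: open_admissibleGr.
- by split=> //; exact: orbit_open_admissible.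
- exact: subbundle_kspace.
- by move=> y gy v; exact: kspace_null.
- split; first exact/submanifold_sig_orbit/open_admissibleGr.
  by apply: defining_kspace => // y gy [_ /(admissibleGr_sigP gy)].
Qed.
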